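(* Let $\mathbb{T}^d=\{x\in\mathbb{R}^d:x_1\ge0,\dots,x_d\ge0,\ 1-|x|\ge0\}$ with $|x|=\sum_{j=1}^d|x_j|$, and let $W^T_{\kappa,\mu}$ be either of the following weight functions on $\mathbb{T}^d$: (i) $W^T_{\kappa,\mu}(x)=\left(\prod_{i=1}^d x_i^{\kappa_i-1/2}\right)(1-|x|)^{\kappa_{d+1}-1/2}$ with $\kappa_1,\dots,\kappa_{d+1}\ge0$ (here $\mu=\kappa_{d+1}$); (ii) $W^T_{\kappa,\mu}(x)=\prod_{i=1}^d x_i^{\kappa'-1/2}\prod_{1\le i<j\le d}|x_i-x_j|^{\kappa}\,(1-|x|)^{\mu-1/2}$ with $\kappa',\kappa,\mu\ge0$. Then there is a constant $C_{d,\kappa,\mu}>0$, depending only on $d$ and the parameters of the weight, such that for every real-valued $f\in C^1(\mathbb{T}^d)$ with $\int_{\mathbb{T}^d}f(x)W^T_{\kappa,\mu}(x)\,dx=0$ and $\int_{\mathbb{T}^d}|f(x)|^2W^T_{\kappa,\mu}(x)\,dx=1$, $$\left[\min_{y\in\mathbb{T}^d}\int_{\mathbb{T}^d}\left(1-\langle\psi^{-1}(x),\psi^{-1}(y)\rangle\right)|f(x)|^2W^T_{\kappa,\mu}(x)\,dx\right]\left[\int_{\mathbb{T}^d}\left|\sqrt{-\Delta^T_{\kappa,\mu}}\,f(x)\right|^2W^T_{\kappa,\mu}(x)\,dx\right]\ge C_{d,\kappa,\mu},$$ where $\psi^{-1}(x)=(\sqrt{x_1},\sqrt{x_2},\dot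s,\sqrt{x_d})$.
   Context: $\langle\cdot,\cdot\rangle$ and $\|\cdot\|$ are the Euclidean inner product and norm on $\mathbb{R}^d$. $\mathbb{B}^d=\{x\in\mathbb{R}^d:\|x\|\le1\}$, and $\psi:\mathbb{B}^d\to\mathbb{T}^d$ is $\psi(x)=(x_1^2,\dots,x_d^2)$. $\Delta^T_{\kappa,\mu}$ is the analogue on $\mathbb{T}^d$ of the Dunkl–Laplace–Beltrami operator. It is the second order differential-difference operator for which the space $\mathcal{V}_n^d(W^T_{\kappa,\mu})$ of orthogonal polynomials of degree $n$ (polynomials in $d$ variables of degree at most $n$ that are orthogonal, in $L^2(\mathbb{T}^d;W^T_{\kappa,\mu}\,dx)$, to all polynomials of degree at most $n-1$) is an eigenspace with eigenvalue $-n(n+\lambda)$, where $\lambda=\sum_{i=1}^{d+1}\kappa_i+\frac{d-1}{2}$ in case (i) and $\lambda=d\kappa'+\frac{d(d-1)}{2}\kappa+\mu+\frac{d-1}{2}$ in case (ii). For $\alpha\in\mathbb{R}$, its fractional power is defined in the distributional sense by $\mathrm{proj}_n((-\Delta^T_{\kappa,\mu})^\alpha f)=(n(n+\lambda))^\alpha\,\mathrm{proj}_n(f)$ for $n=0,1,2,\dots$, where $\mathrm{proj}_n$ is the orthogonal projection of $L^2(\mathbb{T}^d;W^T_{\kappa,\mu}\,dx)$ onto $\mathcal{V}_n^d(W^T_{\kappa,\mu})$, and $\sqrt{-\Delta^T_{\kappa,\mu}}=(-\Delta^T_{\kappa,\mu})^{1/2}$. Equivalently, $((-\Delta^T_{\kappa,\mu})^\alpha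 f)\circ\psi=4^{-\alpha}(-\Delta^B)^\alpha(f\circ\psi)$ on $\mathbb{B}^d$. Here $\Delta^B$ is the analogous operator on $\mathbb{B}^d$ for the weight $W^B(x)=|x_1\cdots x_d|\,W^T_{\kappa,\mu}(\psi(x))$, whose eigenspaces are the spaces of orthogonal polynomials of degree $n$ with respect to $W^B$ on $\mathbb{B}^d$, with eigenvalue $-n(n+2\lambda)$ and the same $\lambda$. In case (i) $W^B(x)=\prod_{i=1}^d|x_i|^{2\kappa_i}(1-\|x\|^2)^{\kappa_{d+1}-1/2}$, associated with the group $\mathbb{Z}_2^d$; in case (ii) $W^B(x)=\prod_{i=1}^d|x_i|^{2\kappa'}\prod_{i<j}|x_i^2-x_j^2|^{\kappa}(1-\|x\|^2)^{\mu-1/2}$, associated with the hyperoctahedral group $H_d$. *)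

(* Defs.v *)
From HB Require Import structures.
From mathcomp Require Import all_boot all_order all_algebra.
From mathcomp Require Import all_classical all_reals all_analysis.
From mathcomp Require mpoly.

Set Implicit Arguments.
Unset Strict Implicit.
Unset Printing Implicit Defensive.

Import Order.TTheory GRing.Theory Num.Theory.
Import numFieldNormedType.Exports.

Local Open Scope classical_set_scope.
Local Open Scope ring_scope.

(* Borel sigma-algebra of R^d, generated by the coordinate maps, as the library
   does for n.-tuple. *)
Definition rV_display : measure_display -> measure_display.
Proof. exact. Qed.

Section measurable_rV.
Context {d} {T : sigmaRingType d}.
Variable n : nat.

Let coors : 'I_n -> 'rV[T]_n -> T := fun i x => x ord0 i.

Let rV_set0 : g_sigma_preimage coors set0.
Proof. exact: sigma_algebra0. Qed.

Let rV_setC A : g_sigma_preimage coors A -> g_sigma_preimage coors (~` A).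
Proof. exact: sigma_algebraC. Qed.

Let rV_bigcup (F : (set 'rV[T]_n)^nat) :
  (forall i, g_sigma_preimage coors (F i)) ->
  g_sigma_preimage coors (\bigcup_i (F i)).
Proof. exact: sigma_algebra_bigcup. Qed.

HB.instance Definition _ := @isMeasurable.Build (rV_display d)
  'rV[T]_n (g_sigma_preimage coors) rV_set0 rV_setC rV_bigcup.

Lemma measurable_coord i : measurable_fun [set: 'rV[T]_n] (fun x => x ord0 i).
Proof.
move=> _ Y mY; rewrite setTI; apply: sub_sigma_algebra => /=.
rewrite -bigcup_seq/=; exists i => /=; first by rewrite mem_index_enum.
by exists Y => //; rewrite setTI.
Qed.

Lemma measurable_fun_rVP d' (S : measurableType d') (f : S -> 'rV[T]_n) :
  (forall i, measurable_fun [set: S] (fun x => f x ord0 i)) ->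
  measurable_fun [set: S] f.
Proof.
move=> mf _ A mA; rewrite setTI.
have : preimage_set_system [set: S] f (g_sigma_preimage coors) (f @^-1` A).
  by exists A => //; rewrite setTI.
rewrite -g_sigma_preimage_comp; apply: smallest_sub.
  exact: sigma_algebra_measurable.
rewrite -bigcup_seq; apply: bigcup_sub => i _ _ [B mB <-].
exact: mf.
Qed.

End measurable_rV.

Section lebesgue_rV.
Variable R : realType.

Definition rV_cons d (p : measurableTypeR R * 'rV[R]_d) : 'rV[R]_d.+1 :=
  row_mx p.1%:M p.2.

Lemma rV_cons0 d p : @rV_cons d p ord0 ord0 = p.1.
Proof.
have -> : ord0 = lshift d (ord0 : 'I_1) :> 'I_d.+1 by exact: val_inj.
by rewrite [LHS](row_mxEl _ p.2) mxE eqxx mulr1n.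
Qed.

Lemma rV_consS d p i : @rV_cons d p ord0 (lift ord0 i) = p.2 ord0 i.
Proof.
have -> : lift ord0 i = rshift 1 i :> 'I_d.+1 by exact: val_inj.
exact: (row_mxEr _ p.2).
Qed.

Lemma measurable_rV_cons d : measurable_fun setT (@rV_cons d).
Proof.
apply: measurable_fun_rVP => i; case: (unliftP ord0 i) => [j|] ->.
  under eq_fun do rewrite rV_consS.
  exact: measurableT_comp (measurable_coord j) measurable_snd.
under eq_fun do rewrite rV_cons0.
exact: measurable_fst.
Qed.

HB.instance Definition _ d :=
  isMeasurableFun.Build _ _ _ _ (@rV_cons d) (@measurable_rV_cons d).

Section step.
Variables (d : nat) (m : {sigma_finite_measure set 'rV[R]_d -> \bar R}).

Definition lebesgue_rV_step : set 'rV[R]_d.+1 -> \bar R :=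
  pushforward (lebesgue_measure \x m)%E (@rV_cons d).

Let lebesgue_rV_step0 : lebesgue_rV_step set0 = 0%E.
Proof. exact: measure0. Qed.

Let lebesgue_rV_step_ge0 A : (0 <= lebesgue_rV_step A)%E.
Proof. exact: measure_ge0. Qed.

Let lebesgue_rV_step_sigma_additive : semi_sigma_additive lebesgue_rV_step.
Proof. exact: measure_semi_sigma_additive. Qed.

HB.instance Definition _ := isMeasure.Build _ _ _ lebesgue_rV_step
  lebesgue_rV_step0 lebesgue_rV_step_ge0 lebesgue_rV_step_sigma_additive.

Let lebesgue_rV_step_sigma_finite : sigma_finite setT lebesgue_rV_step.
Proof.
have [F [TF mF]] : exists F : (set (measurableTypeR R * 'rV[R]_d))^nat,
    setT = \bigcup_n F n /\
    forall n, measurable (F n) /\ ((lebesgue_measure \x m) (F n) < +oo)%E.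
  have /sigma_finiteP[F [TF ndF Foo]] := sigma_finiteT (@lebesgue_measure R).
  have /sigma_finiteP[G [TG ndG Goo]] := sigma_finiteT m.
  exists (fun n => F n `*` G n); split.
    rewrite -setXTT TF TG predeqE => -[x y]; split.
      move=> [/= [n _ Fnx] [k _ Gky]]; exists (maxn n k) => //; split.
      - by move: x Fnx; exact/subsetPset/ndF/leq_maxl.
      - by move: y Gky; exact/subsetPset/ndG/leq_maxr.
    by move=> [n _ []/= ? ?]; split; exists n.
  move=> k; have [? ?] := Foo k; have [? ?] := Goo k.
  split; first exact: measurableX.
  by rewrite product_measure1E// lte_mul_pinfty// ge0_fin_numE.
pose g (x : 'rV[R]_d.+1) : measurableTypeR R * 'rV[R]_d :=
  (x ord0 ord0, \row_j x ord0 (lift ord0 j)).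
have mg : measurable_fun setT g.
  apply: measurable_fun_pair; first exact: measurable_coord.
  apply: measurable_fun_rVP => j.
  under eq_fun do rewrite mxE.
  exact: measurable_coord.
have gK : cancel (@rV_cons d) g.
  move=> [a x]; rewrite /g rV_cons0; congr pair.
  by apply/rowP => j; rewrite mxE rV_consS.
exists (fun n => g @^-1` F n).
  by rewrite -preimage_bigcup -TF preimage_setT.
move=> n; have [mFn Fn] := mF n; split.
  by rewrite -[X in measurable X]setTI; exact: mg.
rewrite /lebesgue_rV_step /pushforward -comp_preimage.
by have -> : g \o @rV_cons d = id by exact/funext.
Qed.

HB.instance Definition _ :=
  Measure_isSigmaFinite.Build _ _ _ lebesgue_rV_step lebesgue_rV_step_sigma_finite.

End step.

Fixpoint lebesgue_rV (d : nat) :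
    {sigma_finite_measure set 'rV[R]_d -> \bar R} :=
  if d is d'.+1 then lebesgue_rV_step (lebesgue_rV d')
  else dirac (0 : 'rV[R]_0).

Lemma lebesgue_rV_box d (A : 'I_d -> set R) : (forall i, measurable (A i)) ->
  lebesgue_rV d [set x | forall i, A i (x ord0 i)] =
  (\prod_(i < d) lebesgue_measure (A i))%E.
Proof.
elim: d A => [|d IH] A mA.
  by rewrite big_ord0 /= diracE mem_set// => -[].
rewrite big_ord_recl -(IH (fun i => A (lift ord0 i)))//=.
rewrite /lebesgue_rV_step /pushforward.
set B := [set x : 'rV[R]_d | forall i, A (lift ord0 i) (x ord0 i)].
have -> : @rV_cons d @^-1` [set x | forall i, A i (x ord0 i)] = A ord0 `*` B.
  apply/seteqP; split => [[a x] /= Ax|[a x] /= [Aa Ax] i].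
    split; first by have := Ax ord0; rewrite rV_cons0.
    by move=> i; have := Ax (lift ord0 i); rewrite rV_consS.
  by case: (unliftP ord0 i) => [j|] ->; rewrite ?rV_consS// rV_cons0.
rewrite product_measure1E//; first exact: mA.
have -> : B = \bigcap_(i in [set: 'I_d])
    ((fun x : 'rV[R]_d => x ord0 i) @^-1` A (lift ord0 i)).
  by apply/seteqP; split => [x /= Ax i _|x /= Ax i]; [exact: Ax|exact: (Ax i I)].
apply: fin_bigcap_measurable => // i _.
by rewrite -[X in measurable X]setTI; exact: measurable_coord.
Qed.

End lebesgue_rV.

Section simplex.
Variables (R : realType) (d : nat).

Definition dotr (x y : 'rV[R]_d) : R := \sum_(i < d) x ord0 i * y ord0 i.

Definition l1norm (x : 'rV[R]_d) : R := \sum_(i < d) `|x ord0 i|.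

Definition simplex : set 'rV[R]_d :=
  [set x : 'rV[R]_d | (forall i, 0 <= x ord0 i) /\ 0 <= 1 - l1norm x].

Definition psi_inv (x : 'rV[R]_d) : 'rV[R]_d := \row_i Num.sqrt (x ord0 i).

(* C^1 up to the boundary: the partial derivatives in the interior extend
   continuously to the closed simplex. *)
Definition C1_simplex (f : 'rV[R]_d -> R) : Prop :=
  {within simplex, continuous f} /\
  forall i : 'I_d, exists2 g : 'rV[R]_d -> R, {within simplex, continuous g} &
    forall x : 'rV[R]_d, simplex° x -> is_derive x (delta_mx ord0 i) f (g x).

(* Weight (i): kappa_1, ..., kappa_(d+1) is indexed by 'I_d.+1, kappa_(d+1) being
   the value at ord_max.  Weight (ii): kappa', kappa, mu, in this order. *)
Inductive simplex_weight : Type :=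
| ClassicalWeight of ('I_d.+1 -> R)
| SymmetricWeight of R & R & R.

Definition nonneg_parameters (w : simplex_weight) : Prop :=
  match w with
  | ClassicalWeight kappa => forall i, 0 <= kappa i
  | SymmetricWeight kappa' kappa mu => [/\ 0 <= kappa', 0 <= kappa & 0 <= mu]
  end.

(* A negative power of 0 is 0 here, which only matters on a null set. *)
Definition weight (w : simplex_weight) (x : 'rV[R]_d) : R :=
  match w with
  | ClassicalWeight kappa =>
      (\prod_(i < d) x ord0 i `^ (kappa (widen_ord (leqnSn d) i) - 2^-1)) *
      (1 - l1norm x) `^ (kappa ord_max - 2^-1)
  | SymmetricWeight kappa' kappa mu =>
      (\prod_(i < d) x ord0 i `^ (kappa' - 2^-1)) *
      (\prod_(i < d) \prod_(j < d | (i < j)%N) `|x ord0 i - x ord0 j| `^ kappa) *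
      (1 - l1norm x) `^ (mu - 2^-1)
  end.

Definition weight_lambda (w : simplex_weight) : R :=
  match w with
  | ClassicalWeight kappa => \sum_(i < d.+1) kappa i + (d%:R - 1) / 2
  | SymmetricWeight kappa' kappa mu =>
      d%:R * kappa' + d%:R * (d%:R - 1) / 2 * kappa + mu + (d%:R - 1) / 2
  end.

End simplex.

Section polynomials.
(* Importing mpoly with its notations clashes with those of analysis. *)
Import -(notations) mpoly.
Variables (R : realType) (d : nat).

(* Polynomial functions of total degree < n (msize is the total degree plus
   one, and 0 for the zero polynomial). *)
Definition poly_deg_lt (n : nat) : set ('rV[R]_d -> R) :=
  [set p | exists2 P : mpoly d R, (msize P <= n)%N &
           p = fun x : 'rV[R]_d => meval (x ord0) P].

End polynomials.

Section fractional_power.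
Variables (R : realType) (d : nat) (w : simplex_weight R d).
Implicit Types f g p q : 'rV[R]_d -> R.

Definition weighted_integral f : \bar R :=
  (\int[lebesgue_rV R d]_(x in @simplex R d) (f x * weight w x)%:E)%E.

Definition L2_simplex f : Prop :=
  measurable_fun (@simplex R d) f /\
  (weighted_integral (fun x => (`|f x| ^+ 2)%R) < +oo)%E.

Definition W_orthogonal f g : Prop :=
  weighted_integral (fun x => f x * g x) = 0%E.

Definition ortho_poly (n : nat) : set ('rV[R]_d -> R) :=
  [set p | poly_deg_lt n.+1 p /\ forall q, poly_deg_lt n q -> W_orthogonal p q].

Definition is_proj (n : nat) f p : Prop :=
  ortho_poly n p /\
  forall q, ortho_poly n q -> W_orthogonal (fun x => f x - p x) q.

Definition proj_ortho (n : nat) f : 'rV[R]_d -> R := xget (fun=> 0) (is_proj n f).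

Definition is_frac_laplacian (alpha : R) f g : Prop :=
  L2_simplex g /\
  forall n x, proj_ortho n g x =
    (n%:R * (n%:R + weight_lambda w)) `^ alpha * proj_ortho n f x.

(* The integral of |(-Delta)^alpha f|^2 W.  The L^2 functions representing the
   distribution (-Delta)^alpha f agree almost everywhere, so the infimum is over
   at most one value; it is +oo if (-Delta)^alpha f is not in L^2. *)
Definition frac_laplacian_sqnorm (alpha : R) f : \bar R :=
  ereal_inf [set weighted_integral (fun x => `|g x| ^+ 2) |
             g in is_frac_laplacian alpha f].

Definition sqrt_laplacian_sqnorm f : \bar R := frac_laplacian_sqnorm 2^-1 f.

Definition dispersion f (y : 'rV[R]_d) : \bar R :=
  weighted_integral (fun x => (1 - dotr (psi_inv x) (psi_inv y)) * `|f x| ^+ 2).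

End fractional_power.

Definition is_minimum (R : realType) (A : set (\bar R)) (m : \bar R) : Prop :=
  A m /\ lbound A m.

(* Main.v *)
From HB Require Import structures.
Require Import Defs.
From mathcomp Require Import all_boot all_order all_algebra.
From mathcomp Require Import all_classical all_reals all_analysis.
From mathcomp Require Import measurable_realfun.
From mathcomp Require Import ring lra.
From mathcomp Require mpoly.

Set Implicit Arguments.
Unset Strict Implicit.
Unset Printing Implicit Defensive.

Import Order.TTheory GRing.Theory Num.Theory.
Import numFieldNormedType.Exports.
Import -(notations) mpoly.

Local Open Scope classical_set_scope.
Local Open Scope ring_scope.

(** The dispersion only matters through the distance to the facet [|x| = 1].
Since [<a, b> <= (|a|^2 + |b|^2) / 2], with [|sqrt x|^2 = |x|] and
[|sqrt y|^2 = |y| <= 1], the factor [1 - <sqrt x, sqrt y>] is at least [t / 2],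
where [t = 1 - |x|].  Every dispersion of [f] is thus at least half of the facet
moment [delta = int t f^2 W], and it is enough to bound from below the product
of [delta] and the squared norm of the square root of the Laplacian.  This is a
Heisenberg inequality in the radial direction alone.

Both weights have the form [W = H t^b] with [H] homogeneous of some degree [h].
Let [I] be integration against [W], [beta = b + 1], [gamma = d + h + beta].  One
identity carries all the information about the weight: for [G] homogeneous of
degree [n], [(n + gamma) I(t G) = beta I(G)]
([weighted_integral_homogeneous]).  It comes from the scaling of Lebesgue measure
and from writing [t^(b+1) / (b+1)] as an integral of translates of [t^b].  With
the Euler operator [X], which multiplies a homogeneous polynomial by its degree,
it becomes the integration by parts [I(t XG) = I((beta - gamma t) G)]
([poly_mean_parts]).

For [G = P^2] this reads [beta I(P^2) = 2 I(t P XP) + gamma I(t P^2)], so the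
Cauchy-Schwarz inequality bounds [beta I(P^2)] by [sqrt (I(t P^2))] times
[2 sqrt D(P) + gamma sqrt I(P^2)], where [D(P) = I(t (XP)^2)] is a radial energy.
The energy is controlled by the spectrum.  Integrating by parts once more,
[D(P, Q) = I(Q KP)] for an operator [K] that raises degrees by at most one; hence
orthogonal polynomials of degrees [m] and [n] have no mutual energy when
[|m - n| >= 2] ([energy_ortho]), and splitting a sum of blocks [P_n] by the parity
of [n] gives [D(sum P_n) <= 2 sum D(P_n)] ([energy_sum_le]).  On a single block
the energy is computed exactly, and it is [O(n^2) I(P_n^2)]
([energy_block_le]).  As [lambda >= 0], [n^2 <= n (n + lambda)], so that [D(P)] is
at most a multiple of the spectral energy ([heisenberg_blocks]).

To pass from polynomials to [f], take for [P] the partial sums of the projections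
of [f].  They converge to [f] in [L^2], because Bernstein polynomials approximate
[f] uniformly ([polynomial_approximation]); Bessel's inequality, applied to an
[L^2] representative [g] of the square root of the Laplacian of [f], bounds the
spectral energies of all partial sums by [|g|^2] ([spectral_heisenberg]).  The
vanishing mean of [f] removes the block of degree 0, and the other blocks satisfy
[I(P_n^2) <= n^2 I(P_n^2)]; this absorbs the lower order term.  If no such [g]
exists, the second factor is infinite and only [delta > 0] is needed, which holds
because the facet is a null set ([facet_moment_gt0]).  The minimum over [y] is
attained explicitly ([dispersion_minimum]). *)

(** * Dilations of Lebesgue measure *)

Section scaling.
Variable R : realType.
Local Open Scope ereal_scope.
Local Notation leb := lebesgue_measure.

Lemma ge0_integral_dilation1 (r : R) (F : R -> \bar R) :
  (0 < r)%R -> measurable_fun [set: R] F -> (forall x, 0 <= F x) ->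
  \int[leb]_x F (r * x)%R = (r^-1)%:E * \int[leb]_x F x.
Proof.
move=> r0 mF F0.
have mr : measurable_fun [set: R] ( *%R r : _ -> measurableTypeR R).
  exact: measurable_funM.
pose rn := NngNum (ltW r0).
have E A : measurable A ->
    leb A = mscale rn (pushforward leb ( *%R r : _ -> measurableTypeR R)) A.
  apply: lebesgue_measure_unique => //= _ [[a b]] _ <-.
  rewrite /mscale/= /pushforward.
  rewrite [X in _ * lebesgue_measure X](_ : _ = `](a / r)%R, (b / r)%R]%classic); last first.
    apply/seteqP; split => x /=; rewrite !in_itv/=;
    by rewrite ltr_pdivrMr// ler_pdivlMr// mulrC.
  rewrite !lebesgue_measure_itv/= !lte_fin ltr_pM2r ?invr_gt0//.
  case: ifP => _; last by rewrite mule0.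
  by rewrite -!EFinD -EFinM -mulrBl mulrCA divff ?gt_eqF// mulr1.
rewrite [X in _ = _ * X](eq_measure_integral (mscale rn (pushforward leb ( *%R r : _ -> measurableTypeR R)))); last first.
  by move=> A mA _; exact: E.
rewrite ge0_integral_mscale//= ge0_integral_pushforward//.
by rewrite preimage_setT muleA -EFinM mulVf ?gt_eqF// mul1e.
Qed.

(** The form of Tonelli's theorem that makes inductions on the dimension possible. *)
Lemma ge0_integral_rV_cons d (F : 'rV[R]_d.+1 -> \bar R) :
  measurable_fun [set: 'rV[R]_d.+1] F -> (forall x, 0 <= F x) ->
  \int[lebesgue_rV R d.+1]_x F x =
  \int[leb]_a \int[lebesgue_rV R d]_x F (rV_cons (a, x)).
Proof.
move=> mF F0; rewrite /= ge0_integral_pushforward// ?preimage_setT.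
  rewrite fubini_tonelli1 => [//||z]; last exact: F0.
  exact: (measurableT_comp mF (@measurable_rV_cons R d)).
Qed.

Lemma measurable_rV_scale d (r : R) :
  measurable_fun [set: 'rV[R]_d] (fun x : 'rV[R]_d => (r *: x)%R : 'rV[R]_d).
Proof.
apply: measurable_fun_rVP => i.
under eq_fun do rewrite mxE.
by apply: measurable_funM => //; exact: measurable_coord.
Qed.

Lemma ge0_integral_dilation d (r : R) (F : 'rV[R]_d -> \bar R) :
  (0 < r)%R -> measurable_fun [set: 'rV[R]_d] F -> (forall x, 0 <= F x) ->
  \int[lebesgue_rV R d]_x F (r *: x)%R = ((r ^- d)%R)%:E * \int[lebesgue_rV R d]_x F x.
Proof.
move=> r0; elim: d F => [|d IH] F mF F0.
  rewrite expr0 invr1 mul1e; apply: eq_integral => x _; congr F.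
  by apply/rowP => -[].
rewrite !ge0_integral_rV_cons//; last first.
  exact: measurableT_comp mF (@measurable_rV_scale _ _).
have mFc : measurable_fun [set: _] (F \o @rV_cons R d).
  exact: (measurableT_comp mF (@measurable_rV_cons R d)).
pose G (a : R) := \int[lebesgue_rV R d]_x F (rV_cons (a, x)).
have mG : measurable_fun [set: R] G.
  by apply: (measurable_fun_fubini_tonelli_F (F \o @rV_cons R d)) => //= z; exact: F0.
have G0 a : 0 <= G a by apply: integral_ge0.
have mGr : measurable_fun [set: R] (G \o *%R r).
  by apply: (measurableT_comp mG); exact: measurable_funM.
transitivity (\int[leb]_a ((r ^- d)%R%:E * (G \o *%R r) a)).
  apply: eq_integral => a _ /=.
  rewrite /G -IH//.
  - apply: eq_integral => x _; congr F; apply/rowP => i; rewrite mxE.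
    by case: (unliftP ord0 i) => [j|] ->; rewrite ?rV_consS ?rV_cons0//= mxE.
  - exact: measurableT_comp mFc (pair1_measurable _).
have rd0 : 0%:E <= (r ^- d)%R%:E by rewrite lee_fin invr_ge0 exprn_ge0// ltW.
have Z := @ge0_integralZl _ _ R lebesgue_measure setT measurableT (G \o *%R r) mGr _ (fun a _ => G0 (r * a)%R) rd0.
rewrite Z (ge0_integral_dilation1 r0 mG G0).
rewrite muleA -EFinM; congr (_%:E * _).
by rewrite exprS invfM mulrC.
Qed.
End scaling.

(** * Integrals of translated powers *)

Section pospow.
Variable R : realType.
Local Notation leb := lebesgue_measure.

(** Extending powers by 0 to the left of 0 turns integrals over the scaled
simplices [|x| < u] into integrals over the whole orthant. *)
Definition pospow (b v : R) : R := if 0 < v then v `^ b else 0.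

Lemma pospow_ge0 b v : 0 <= pospow b v.
Proof. by rewrite /pospow; case: ifP => // _; exact: powR_ge0. Qed.

Lemma measurable_pospow b : measurable_fun [set: R] (pospow b).
Proof.
apply: measurable_fun_ifT => //.
exact: measurable_fun_ltr.
Qed.

Lemma pospowM b u v : 0 < u -> pospow b (u * v) = u `^ b * pospow b v.
Proof.
move=> u0; rewrite /pospow pmulr_rgt0//; case: ifP => v0; last by rewrite mulr0.
by rewrite powRM// ltW.
Qed.

Lemma integral_powR_sub (b s c : R) : -1 < b -> s < c -> c < 1 ->
  (\int[leb]_(u in `[c, 1%R]) ((u - s) `^ b)%:E =
   ((b + 1)^-1 * ((1 - s) `^ (b + 1) - (c - s) `^ (b + 1)))%:E)%E.
Proof.
move=> b1 sc c1.
have b0 : b + 1 != 0 by rewrite gt_eqF//; lra.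
pose F u := (b + 1)^-1 * (u - s) `^ (b + 1).
have dF u : s < u -> is_derive u 1 F ((u - s) `^ b).
  move=> su.
  have us : 0 < u - s by rewrite subr_gt0.
  have ds : is_derive u 1 (fun u => u - s) 1.
    by apply: is_derive_eq; rewrite subr0.
  have H := @is_derive1_comp R (@powR R ^~ (b + 1)) (fun u => u - s) _ _ _
    (@is_derive1_powR R (b + 1) _ us) ds.
  have HZ := @is_deriveZ _ _ _ _ (b + 1)^-1 _ _ _ H.
  by apply: (is_derive_eq HZ); rewrite addrK mulr1 /GRing.scale/= mulrA mulVf// mul1r.
rewrite (@continuous_FTC2 _ _ F)//.
- by rewrite /F -EFinB mulrBr.
- apply: derivable_within_continuous => v; rewrite in_itv/= => /andP[cv _].
  have vs : 0 < v - s by rewrite subr_gt0 (lt_le_trans sc).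
  have dv : is_derive v 1 (fun u => u - s) 1.
    by apply: is_derive_eq; rewrite subr0.
  exact: (@ex_derive _ _ _ _ _ _ _ (@is_derive1_comp R (@powR R ^~ b) (fun u => u - s)
    _ _ _ (@is_derive1_powR R b _ vs) dv)).
- split.
  + by move=> u; rewrite in_itv/= => /andP[cu _]; apply: (@ex_derive _ _ _ _ _ _ _ (dF _ (lt_trans sc cu))).
  + apply: cvg_at_right_filter.
    apply: differentiable_continuous; apply/derivable1_diffP.
    by apply: (@ex_derive _ _ _ _ _ _ _ (dF _ sc)).
  + apply: cvg_at_left_filter.
    apply: differentiable_continuous; apply/derivable1_diffP.
    by apply: (@ex_derive _ _ _ _ _ _ _ (dF _ (lt_trans sc c1))).
- move=> u; rewrite in_itv/= => /andP[cu _].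
  by rewrite derive1E; apply: derive_val; apply: dF; exact: lt_trans cu.
Qed.

(** This exchanges one power of [1 - s] for an average over scaled simplices;
used with [s = |x|], and with [s = 0] for the scaling parameter itself. *)
Lemma integral_pospow (b s : R) : -1 < b -> 0 <= s ->
  (\int[leb]_(u in `]0%R, 1%R]) (pospow b (u - s))%:E =
   ((b + 1)^-1 * pospow (b + 1) (1 - s))%:E)%E.
Proof.
move=> b1 s0; have b0 : 0 < b + 1 by lra.
have [s1|s1] := leP 1 s.
  rewrite /pospow [in RHS]ltNge subr_le0 s1/= mulr0; apply: integral0_eq => u /=.
  rewrite in_itv/= => /andP[_ u1].
  by rewrite ltNge subr_le0 (le_trans u1).
(* The integrand may be unbounded near s: the interval is exhausted by the
   segments from c n to 1. *)
pose c n := s + (1 - s) / n.+2%:R.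
have sc n : s < c n by rewrite ltrDl divr_gt0// subr_gt0.
have c1 n : c n < 1.
  rewrite /c -ltrBrDl ltr_pdivrMr// ltr_pMr ?subr_gt0//.
  by rewrite ltr1n.
have nd : nondecreasing_seq (fun n => `[c n, 1]%classic : set R).
  move=> m n mn; rewrite subsetEset => u /=; rewrite !in_itv/= => /andP[cu ->].
  rewrite andbT (le_trans _ cu)// lerD2l ler_pM2l ?subr_gt0//.
  by rewrite lef_pV2 ?posrE// ler_nat.
have U : \bigcup_n `[c n, 1]%classic = `]s, 1]%classic :> set R.
  apply/seteqP; split => u /=.
    move=> [n _] /=; rewrite !in_itv/= => /andP[cu ->].
    by rewrite (lt_le_trans (sc n)).
  rewrite in_itv/= => /andP[su u1].
  have [n Hn] := @ltr_add_invr R 0 ((u - s) / (1 - s)) ltac:(by rewrite divr_gt0// subr_gt0).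
  exists n => //=; rewrite in_itv/= u1 andbT /c -lerBrDl mulrC.
  rewrite -ler_pdivlMr ?subr_gt0//; apply: le_trans (ltW Hn).
  by rewrite add0r lef_pV2 ?posrE// ler_nat.
have mp : measurable_fun [set: R] (fun u => (pospow b (u - s))%:E).
  by apply/measurable_EFinP; apply: measurableT_comp (measurable_pospow b) _; exact: measurable_funB.
transitivity (\int[leb]_(u in `]s, 1%R]) (pospow b (u - s))%:E)%E.
  rewrite integral_mkcond [RHS]integral_mkcond; apply: eq_integral => u _.
  rewrite /patch !mem_setE !in_itv/=.
  have [su|us] := ltP s u; first by rewrite (le_lt_trans s0 su).
  by rewrite /pospow subr_gt0 [s < u]ltNge us/=; case: ifP.
rewrite -U.
have cvg1 : (\int[leb]_(u in `[c n, 1%R]) (pospow b (u - s))%:E @[n --> \oo] -->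
    \int[leb]_(u in \bigcup_n `[c n, 1%R]%classic) (pospow b (u - s))%:E)%E.
  apply: ge0_nondecreasing_set_cvg_integral => //.
  - by move=> n; exact: measurable_funTS.
  - by move=> n u _; rewrite lee_fin pospow_ge0.
apply: cvg_unique cvg1 _ => //.
rewrite (_ : (fun i => _) = EFin \o (fun n => (b + 1)^-1 * ((1 - s) `^ (b + 1) - (c n - s) `^ (b + 1)))).
  apply: cvg_EFin; first exact: nearW.
  rewrite /pospow subr_gt0 s1.
  apply: cvgMr.
  rewrite -[X in _ --> X]subr0; apply: cvgB; first exact: cvg_cst.
  have /cvg_at_rightP := @powR_cvg0 R _ b0; apply; split.
    by move=> n; rewrite subr_gt0.
  rewrite (_ : (fun n => _) = (fun n => (1 - s) * harmonic n.+1)); last first.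
    by apply/funext => n; rewrite /c addrC addKr.
  rewrite -[X in _ --> X](mulr0 (1 - s)); apply: cvgMr.
  by have := @cvg_harmonic R; rewrite -cvg_shiftS.
apply/funext => n /=; rewrite -integral_powR_sub//.
apply: eq_integral => u; rewrite inE/= in_itv/= => /andP[cu _].
by rewrite /pospow subr_gt0 (lt_le_trans (sc n)).
Qed.
End pospow.

(** * Moments of homogeneous functions against powers of 1 - |x| *)

Section moment.
Variable R : realType.
Local Notation leb := lebesgue_measure.

Lemma l1norm_ge0 d (x : 'rV[R]_d) : 0 <= l1norm x.
Proof. by rewrite /l1norm sumr_ge0. Qed.

Lemma l1normZ d (r : R) (x : 'rV[R]_d) : 0 <= r -> l1norm (r *: x) = r * l1norm x.
Proof.
move=> r0; rewrite /l1norm mulr_sumr; apply: eq_bigr => i _.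
by rewrite mxE normrM ger0_norm.
Qed.

Lemma measurable_l1norm d : measurable_fun [set: 'rV[R]_d] (@l1norm R d).
Proof.
apply: measurable_sum => i.
by apply: measurableT_comp => //; exact: measurable_coord.
Qed.

Variables (d : nat) (H : 'rV[R]_d -> R) (h : R).
Hypotheses (mH : measurable_fun [set: 'rV[R]_d] H) (H0 : forall x, 0 <= H x).
Hypothesis HZ : forall r x, 0 < r -> H (r *: x) = r `^ h * H x.

Definition beta_moment (b : R) : \bar R :=
  (\int[lebesgue_rV R d]_x (H x * pospow b (1 - l1norm x))%:E)%E.

Let mHp b u : measurable_fun [set: 'rV[R]_d]
  (fun x => (H x * pospow b (u - l1norm x))%:E).
Proof.
apply/measurable_EFinP; apply: measurable_funM => //.
apply: measurableT_comp (measurable_pospow b) _.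
by apply: measurable_funB => //; exact: measurable_l1norm.
Qed.

Let Hp0 b u x : (0 <= (H x * pospow b (u - l1norm x))%:E)%E.
Proof. by rewrite lee_fin mulr_ge0// pospow_ge0. Qed.

(** The substitution [x = u y]: [H] contributes [u^h], the power of the distance
to the facet [u^b], and Lebesgue measure [u^d]. *)
Lemma beta_moment_scale b u : 0 < u ->
  (\int[lebesgue_rV R d]_x (H x * pospow b (u - l1norm x))%:E =
   (u `^ (d%:R + h + b))%:E * beta_moment b)%E.
Proof.
move=> u0.
pose F x := (H x * pospow b (u - l1norm x))%:E.
have : (\int[lebesgue_rV R d]_x F (u *: x) =
    (u ^- d)%:E * \int[lebesgue_rV R d]_x F x)%E.
  apply: ge0_integral_dilation => //; [exact: mHp|move=> x; exact: Hp0].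
move=> /(congr1 (mule (u ^+ d)%:E)).
have ud : u ^+ d * u ^- d = 1 by rewrite mulfV// expf_neq0// gt_eqF.
rewrite muleA -EFinM ud mul1e => <-.
rewrite (eq_integral (fun x => (u `^ (h + b))%:E * (H x * pospow b (1 - l1norm x))%:E)%E); last first.
  move=> x _; rewrite /F HZ// l1normZ ?ltW// -[X in pospow b (X - _)]mulr1 -mulrBr pospowM//.
  by rewrite -EFinM powRD ?(gt_eqF u0)/= ?implybT//; congr EFin; ring.
rewrite ge0_integralZl//; last by rewrite lee_fin powR_ge0.
rewrite muleA -EFinM; congr (_%:E * _)%E.
rewrite -powR_mulrn ?ltW// -powRD ?addrA//.
by rewrite (gt_eqF u0) implybT.
Qed.

(** With [s = |x|], write [(1 - s)^(b+1) / (b+1)] as the integral over [u] in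
the half-open unit interval of [(u - s)^b] and exchange the integrals.  For fixed [u], scaling makes
the inner integral [u^(d+h+b)] times the moment of exponent [b], and the
remaining integral over [u] is [1 / (d + h + b + 1)].  Both sides may be infinite;
finite moments are a consequence, not a hypothesis. *)
Lemma beta_moment_succ b : -1 < b -> -1 < d%:R + h + b ->
  (beta_moment (b + 1) = ((b + 1) / (d%:R + h + b + 1))%:E * beta_moment b)%E.
Proof.
move=> b1 hb1; have b0 : 0 < b + 1 by lra.
rewrite /beta_moment (eq_integral (fun x => (b + 1)%:E *
   \int[leb]_u (H x * (pospow b (u - l1norm x) * \1_`]0%R, 1%R]%classic u))%:E)%E); last first.
  move=> x _.
  under [in RHS]eq_integral do rewrite EFinM.
  rewrite ge0_integralZl//; last 3 first.
  - apply/measurable_EFinP; apply: measurable_funM => //.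
    apply: measurableT_comp (measurable_pospow b) _.
    exact: measurable_funB.
  - by move=> u _; rewrite lee_fin mulr_ge0// pospow_ge0.
  - exact: H0.
  have -> : (\int[leb]_u (pospow b (u - l1norm x) * \1_`]0%R, 1%R]%classic u)%:E =
      ((b + 1)^-1 * pospow (b + 1) (1 - l1norm x))%:E)%E.
    rewrite -integral_pospow// ?l1norm_ge0// [RHS]integral_mkcond.
    apply: eq_integral => u _; rewrite patchE indicE.
    by case: ifP => _; rewrite ?mulr1 ?mulr0.
  rewrite -!EFinM; congr EFin; field.
  by rewrite gt_eqF.
pose G (z : 'rV[R]_d * measurableTypeR R) : \bar R :=
  (H z.1 * (pospow b (z.2 - l1norm z.1) * \1_`]0%R, 1%R]%classic (z.2 : R)))%:E.
have mG : measurable_fun [set: _] G.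
  apply/measurable_EFinP; apply: measurable_funM.
    exact: measurableT_comp mH measurable_fst.
  apply: measurable_funM.
    apply: measurableT_comp (measurable_pospow b) _.
    apply: measurable_funB; first exact: measurable_snd.
    exact: measurableT_comp (@measurable_l1norm d) measurable_fst.
  apply: measurableT_comp measurable_snd.
  exact: measurable_indic.
have G0 z : (0 <= G z)%E.
  by rewrite lee_fin mulr_ge0// mulr_ge0// pospow_ge0.
rewrite ge0_integralZl//; last 3 first.
- exact: (measurable_fun_fubini_tonelli_F G).
- by move=> x _; apply: integral_ge0 => u _; exact: (G0 (x, u)).
- by rewrite lee_fin ltW.
rewrite (fubini_tonelli (m2 := leb) G)//.
have J0 : (0 <= beta_moment b)%E by apply: integral_ge0 => x _; exact: Hp0.
pose K (u : R) := (pospow (d%:R + h + b) (u - 0) * \1_`]0%R, 1%R]%classic u)%:E.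
transitivity ((b + 1)%:E * \int[leb]_u (K u * beta_moment b))%E.
  congr (_ * _)%E; apply: eq_integral => u _; rewrite /fubini_G /G /K /= indicE subr0.
  have [u01|u01] := boolP (u \in `]0%R, 1%R]%classic); last first.
    rewrite mulr0 mul0e; apply: integral0_eq => x _.
    by rewrite !mulr0.
  rewrite mulr1 /pospow.
  have u0 : 0 < u by move: u01; rewrite inE/= in_itv/= => /andP[].
  rewrite u0 -beta_moment_scale//; apply: eq_integral => x _.
  by rewrite mulr1.
have mK : measurable_fun [set: R] K.
  apply/measurable_EFinP; apply: measurable_funM; last exact: measurable_indic.
  by apply: measurableT_comp (measurable_pospow _) _; exact: measurable_funB.
have K0 u : (0 <= K u)%E by rewrite lee_fin mulr_ge0// pospow_ge0.
have Z := @ge0_integralZr _ _ R lebesgue_measure setT measurableT K mK _ (fun a _ => K0 a) J0.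
rewrite Z muleA.
have -> : (\int[leb]_u K u = ((d%:R + h + b + 1)^-1)%:E)%E.
  transitivity (\int[leb]_(u in `]0%R, 1%R]) (pospow (d%:R + h + b) (u - 0))%:E)%E.
    rewrite [RHS]integral_mkcond; apply: eq_integral => u _; rewrite patchE /K indicE.
    by case: ifP => _; rewrite ?mulr1 ?mulr0.
  by rewrite integral_pospow// /pospow subr0 ltr01 powR1 mulr1.
by rewrite -EFinM.
Qed.
End moment.

(** * The two weights: homogeneity and bounds *)

Section weights.
Variables (R : realType) (d : nat).
Implicit Types (w : simplex_weight R d) (x : 'rV[R]_d).

Definition facet_exponent w : R :=
  match w with
  | ClassicalWeight kappa => kappa ord_max - 2^-1
  | SymmetricWeight kappa' kappa mu => mu - 2^-1
  end.

Definition homogeneous_part w x : R :=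
  match w with
  | ClassicalWeight kappa =>
      \prod_(i < d) x ord0 i `^ (kappa (widen_ord (leqnSn d) i) - 2^-1)
  | SymmetricWeight kappa' kappa mu =>
      (\prod_(i < d) x ord0 i `^ (kappa' - 2^-1)) *
      (\prod_(i < d) \prod_(j < d | (i < j)%N) `|x ord0 i - x ord0 j| `^ kappa)
  end.

Definition homogeneous_degree w : R :=
  match w with
  | ClassicalWeight kappa =>
      \sum_(i < d) (kappa (widen_ord (leqnSn d) i) - 2^-1)
  | SymmetricWeight kappa' kappa mu =>
      (\sum_(i < d) (kappa' - 2^-1)) +
      (\sum_(i < d) \sum_(j < d | (i < j)%N) kappa)
  end.

Lemma weightE w x :
  weight w x = homogeneous_part w x * (1 - l1norm x) `^ facet_exponent w.
Proof. by case: w. Qed.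

Lemma homogeneous_part_ge0 w x : 0 <= homogeneous_part w x.
Proof.
case: w => [k|k' k mu] /=; first by apply: prodr_ge0 => i _; exact: powR_ge0.
apply: mulr_ge0; apply: prodr_ge0 => i _; first exact: powR_ge0.
by apply: prodr_ge0 => j _; exact: powR_ge0.
Qed.

Lemma weight_ge0 w x : 0 <= weight w x.
Proof. by rewrite weightE mulr_ge0 ?powR_ge0// homogeneous_part_ge0. Qed.

Lemma measurable_homogeneous_part w :
  measurable_fun [set: 'rV[R]_d] (homogeneous_part w).
Proof.
case: w => [k|k' k mu] /=.
  apply: measurable_prod => i _.
  exact: (measurableT_comp (measurable_powR _) (measurable_coord i)).
apply: measurable_funM; apply: measurable_prod => i _.
  exact: (measurableT_comp (measurable_powR _) (measurable_coord i)).
under eq_fun do rewrite big_mkcond.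
apply: measurable_prod => j _; case: (i < j)%N => //=.
apply: (measurableT_comp (measurable_powR _)); apply: measurableT_comp => //.
by apply: measurable_funB; exact: measurable_coord.
Qed.

Lemma measurable_weight w : measurable_fun [set: 'rV[R]_d] (weight w).
Proof.
rewrite (funext (weightE w)).
apply: measurable_funM; first exact: measurable_homogeneous_part.
apply: (measurableT_comp (measurable_powR _)); apply: measurable_funB => //.
exact: measurable_l1norm.
Qed.

Lemma powR_sum (I : Type) (s : seq I) (P : pred I) (F : I -> R) r : 0 < r ->
  r `^ (\sum_(i <- s | P i) F i) = \prod_(i <- s | P i) r `^ F i.
Proof.
move=> r0; apply: (big_morph (fun z => r `^ z)); last exact: powRr0.
by move=> a c; rewrite powRD// (gt_eqF r0) implybT.
Qed.

Lemma homogeneous_partZ w r x : 0 < r -> (forall i, 0 <= x ord0 i) ->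
  homogeneous_part w (r *: x) = r `^ homogeneous_degree w * homogeneous_part w x.
Proof.
move=> r0 x0; case: w => [k|k' k mu] /=.
  rewrite powR_sum// -big_split; apply: eq_bigr => i _ /=.
  by rewrite mxE powRM// ltW.
rewrite powRD; last by rewrite (gt_eqF r0) implybT.
rewrite mulrACA; congr (_ * _); rewrite powR_sum// -big_split; apply: eq_bigr => i _ /=.
  by rewrite mxE powRM// ltW.
rewrite powR_sum// -big_split; apply: eq_bigr => j _ /=.
by rewrite !mxE -mulrBr normrM (gtr0_norm r0) powRM// ltW.
Qed.

(** The term 1 takes care of nonnegative exponents, and of [0^0 = 1]. *)
Lemma ler_powR_singular (a u : R) : - 2^-1 <= a -> 0 <= u <= 1 ->
  u `^ a <= 1 + pospow (- 2^-1) u.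
Proof.
move=> a2 /andP[]; rewrite le_eqVlt /pospow => /predU1P[<- _|u0 u1].
  by rewrite ltxx addr0 /powR eqxx lern1 leq_b1.
by rewrite u0; apply: ler_wpDl => //; apply: ger_powR; rewrite ?u0.
Qed.

(** The differences [|x_i - x_j|] are at most 1, so that only the singularities
of order [-1/2] on the coordinate hyperplanes remain. *)
Lemma homogeneous_part_le w x : nonneg_parameters w ->
  (forall i, 0 <= x ord0 i <= 1) ->
  homogeneous_part w x <= \prod_(i < d) (1 + pospow (- 2^-1) (x ord0 i)).
Proof.
move=> hw x01; case: w hw => [k k0|k' k mu [k'0 k0 mu0]] /=.
  apply: ler_prod => i _; rewrite powR_ge0/=; apply: ler_powR_singular => //.
  by rewrite lerBrDl subrr.
rewrite -[leRHS]mulr1; apply: ler_pM.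
- by apply: prodr_ge0 => i _; exact: powR_ge0.
- by apply: prodr_ge0 => i _; apply: prodr_ge0 => j _; exact: powR_ge0.
- apply: ler_prod => i _; rewrite powR_ge0/=; apply: ler_powR_singular => //.
  by rewrite lerBrDl subrr.
- apply: prodr_ile1 => i _; rewrite prodr_ge0 => [|j _]; last exact: powR_ge0.
  apply: prodr_ile1 => j _; rewrite powR_ge0/=.
  have xx : `|x ord0 i - x ord0 j| <= 1.
    have := x01 i; have := x01 j => /andP[? ?] /andP[? ?].
    by rewrite ler_norml; apply/andP; split; lra.
  have := ge0_ler_powR k0 (_ : `|x ord0 i - x ord0 j| \in Num.nneg) (_ : 1 \in Num.nneg) xx.
  by rewrite powR1; apply; rewrite nnegrE.
Qed.

Lemma facet_exponent_ge w : nonneg_parameters w -> - 2^-1 <= facet_exponent w.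
Proof.
by case: w => [k k0|k' k mu [_ _ mu0]] /=; rewrite lerBrDl subrr.
Qed.

Lemma homogeneous_degree_ge w : nonneg_parameters w ->
  - (d%:R / 2) <= homogeneous_degree w.
Proof.
have E : - (d%:R / 2) = \sum_(i < d) - 2^-1 :> R.
  by rewrite mulr_natl sumr_const card_ord mulNrn.
case: w => [k k0|k' k mu [k'0 k0 mu0]] /=.
  by rewrite E; apply: ler_sum => i _; rewrite lerBrDl subrr.
rewrite E -[leLHS]addr0; apply: lerD.
  by apply: ler_sum => i _; rewrite lerBrDl subrr.
by apply: sumr_ge0 => i _; apply: sumr_ge0.
Qed.

Lemma weight_lambda_ge0 w : (0 < d)%N -> nonneg_parameters w ->
  0 <= weight_lambda w.
Proof.
move=> d0; have d1 : 0 <= (d%:R - 1) / 2 :> R.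
  by rewrite divr_ge0// subr_ge0 ler1n.
case: w => [k k0|k' k mu [k'0 k0 mu0]] /=; first by rewrite addr_ge0// sumr_ge0.
have p1 : 0 <= d%:R * k' by rewrite mulr_ge0.
have p2 : 0 <= d%:R * (d%:R - 1) / 2 * k by rewrite mulr_ge0// -mulrA mulr_ge0.
by rewrite !addr_ge0.
Qed.
End weights.

(** * Integration over the simplex *)

Section simplex_measure.
Variables (R : realType).
Local Notation leb := lebesgue_measure.

Lemma measurable_simplex d : measurable (@simplex R d).
Proof.
have -> : @simplex R d = (\bigcap_(i in [set: 'I_d])
    ((fun x : 'rV[R]_d => x ord0 i) @^-1` `[0, +oo[%classic)) `&`
    (@l1norm R d @^-1` `]-oo, 1]%classic).
  apply/seteqP; split => [x [x0 x1]|x [x0 x1]].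
    split; first by move=> i _ /=; rewrite in_itv/= andbT.
    by rewrite /= in_itv/= -subr_ge0.
  split; first by move=> i; have := x0 i I; rewrite /= in_itv/= andbT.
  by move: x1; rewrite /= in_itv/= -subr_ge0.
apply: measurableI.
  apply: fin_bigcap_measurable => // i _.
  by rewrite -[X in measurable X]setTI; exact: measurable_coord.
by rewrite -[X in measurable X]setTI; exact: measurable_l1norm.
Qed.

Lemma ge0_integral_prod d (g : R -> R) : measurable_fun [set: R] g ->
  (forall u, 0 <= g u) -> (\int[leb]_u (g u)%:E < +oo)%E ->
  (\int[lebesgue_rV R d]_x (\prod_(i < d) g (x ord0 i))%:E < +oo)%E.
Proof.
move=> mg g0 goo; elim: d => [|d IH].
  under eq_integral do rewrite big_ord0.
  by rewrite integral_cst//= mul1e diracT ltry.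
have mP k : measurable_fun [set: 'rV[R]_k] (fun x : 'rV[R]_k => (\prod_(i < k) g (x ord0 i))%:E).
  apply/measurable_EFinP; apply: measurable_prod => i _.
  exact: (measurableT_comp mg (measurable_coord i)).
have P0 k (x : 'rV[R]_k) : (0 <= (\prod_(i < k) g (x ord0 i))%:E)%E.
  by rewrite lee_fin prodr_ge0.
rewrite (ge0_integral_rV_cons (mP _) (P0 _)).
pose J := (\int[lebesgue_rV R d]_x (\prod_(i < d) g (x ord0 i))%:E)%E.
have J0 : (0 <= J)%E by apply: integral_ge0 => x _; exact: P0.
rewrite (_ : (\int[leb]_a _)%E = (\int[leb]_a ((g a)%:E * J))%E); last first.
  apply: eq_integral => a _.
  have ga : (0 <= (g a)%:E)%E by rewrite lee_fin.
  have Z := @ge0_integralZl _ _ R (lebesgue_rV R d) setT measurableT _ (mP d) _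
    (fun x _ => P0 d x) ga.
  rewrite /J -Z; apply: eq_integral => x _; rewrite big_ord_recl rV_cons0/= EFinM.
  by congr (_ * _%:E)%E; apply: eq_bigr => i _; rewrite rV_consS.
have mgE : measurable_fun [set: R] (fun a => (g a)%:E) by exact/measurable_EFinP.
have gE0 (a : R) : setT a -> (0 <= (g a)%:E)%E by rewrite lee_fin.
have Z := @ge0_integralZr _ _ R lebesgue_measure setT measurableT _ mgE _ gE0 J0.
rewrite Z lte_mul_pinfty//; first exact: integral_ge0.
by rewrite ge0_fin_numE ?integral_ge0.
Qed.

Definition facet_hyperplane d : set 'rV[R]_d := [set x | \sum_(i < d) x ord0 i = 1].
Arguments facet_hyperplane : clear implicits.

Lemma measurable_facet_hyperplane d : measurable (facet_hyperplane d : set 'rV[R]_d).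
Proof.
rewrite -[facet_hyperplane d]setTI.
have : measurable_fun [set: 'rV[R]_d] (fun x : 'rV[R]_d => \sum_(i < d) x ord0 i).
  by apply: measurable_sum => i; exact: measurable_coord.
by move=> /(_ measurableT [set 1] (measurable_set1 1)).
Qed.

(** The first coordinate of a point of the hyperplane is determined by the
others, and points are null for Lebesgue measure on the line. *)
Lemma facet_hyperplane_null d : (0 < d)%N -> lebesgue_rV R d (facet_hyperplane d) = 0%E.
Proof.
case: d => // d _.
have mF := @measurable_facet_hyperplane d.+1.
have mI : measurable_fun [set: 'rV[R]_d.+1] (fun x => (\1_(facet_hyperplane d.+1) x : R)%:E).
  by apply/measurable_EFinP; exact: measurable_indic.
rewrite -[facet_hyperplane _]setIT -integral_indic//=.
rewrite (ge0_integral_rV_cons mI); last by move=> x; rewrite lee_fin.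
pose G (z : measurableTypeR R * 'rV[R]_d) : \bar R :=
  (\1_(facet_hyperplane d.+1) (rV_cons z) : R)%:E.
have mG : measurable_fun [set: _] G := measurableT_comp mI (@measurable_rV_cons R d).
rewrite (fubini_tonelli (m2 := lebesgue_rV R d) G)//; last by move=> z; rewrite lee_fin.
apply: integral0_eq => x _; rewrite /fubini_G /G.
rewrite (_ : (fun _ => _) = (fun a : R => (\1_[set (1 - \sum_(i < d) x ord0 i)] a : R)%:E)); last first.
  apply/funext => a; congr (_%:E); rewrite !indicE; congr (_%:R); congr nat_of_bool.
  have E : \sum_(i < d.+1) rV_cons (a, x) ord0 i = a + \sum_(i < d) x ord0 i.
    rewrite big_ord_recl rV_cons0/=; congr (_ + _).
    by apply: eq_bigr => i _; rewrite rV_consS.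
  apply/idP/idP; rewrite !inE /facet_hyperplane/= E => H; first by rewrite -H addrK.
  by rewrite H subrK.
rewrite integral_indic// setIT; exact: lebesgue_measure_set1.
Qed.

Variable d : nat.
Hypothesis d_gt0 : (0 < d)%N.

Definition orthant : set 'rV[R]_d := [set x | forall i, 0 <= x ord0 i].

Lemma measurable_orthant : measurable orthant.
Proof.
have -> : orthant = \bigcap_(i in [set: 'I_d])
    ((fun x : 'rV[R]_d => x ord0 i) @^-1` `[0, +oo[%classic).
  apply/seteqP; split => [x x0 i _|x x0 i]; first by rewrite /= in_itv/= andbT.
  by have := x0 i I; rewrite /= in_itv/= andbT.
apply: fin_bigcap_measurable => // i _.
by rewrite -[X in measurable X]setTI; exact: measurable_coord.
Qed.

Lemma l1norm_orthant x : orthant x -> l1norm x = \sum_(i < d) x ord0 i.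
Proof. by move=> x0; apply: eq_bigr => i _; rewrite ger0_norm. Qed.

Lemma simplex_coord x i : @simplex R d x -> 0 <= x ord0 i <= 1.
Proof.
move=> [x0 x1]; rewrite x0/=; move: x1; rewrite subr_ge0; apply: le_trans.
rewrite /l1norm (bigD1 i)//= ger0_norm// lerDl.
by apply: sumr_ge0 => j _; exact: normr_ge0.
Qed.

Section simplex_integral.
Variable P : 'rV[R]_d -> R.
Hypotheses (mP : measurable_fun [set: 'rV[R]_d] P) (P0 : forall x, 0 <= P x).

Let H x := P x * \1_orthant x.

Let mH : measurable_fun [set: 'rV[R]_d] H.
Proof.
by apply: measurable_funM => //; apply: measurable_indic; exact: measurable_orthant.
Qed.

(** The integrands agree except on the facet, where [0^0 = 1] may occur on the
left-hand side but not on the right-hand side. *)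
Lemma simplex_integralE b :
  (\int[lebesgue_rV R d]_(x in @simplex R d) (P x * (1 - l1norm x) `^ b)%:E =
   beta_moment H b)%E.
Proof.
have m1 : measurable_fun [set: 'rV[R]_d] (fun x => 1 - l1norm x).
  by apply: measurable_funB => //; exact: measurable_l1norm.
have mf : measurable_fun (@simplex R d) (fun x => (P x * (1 - l1norm x) `^ b)%:E).
  apply: measurable_funTS; apply/measurable_EFinP; apply: measurable_funM => //.
  exact: (measurableT_comp (measurable_powR _) m1).
rewrite integral_mkcond; apply: ge0_ae_eq_integral => //.
- by apply/(measurable_restrictT _ _).1 => //; exact: measurable_simplex.
- apply/measurable_EFinP; apply: measurable_funM => //.
  exact: measurableT_comp (measurable_pospow _) m1.
- by move=> x _; apply: erestrict_ge0 => y _; rewrite lee_fin mulr_ge0// powR_ge0.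
- by move=> x _; rewrite lee_fin mulr_ge0 ?pospow_ge0// /H mulr_ge0.
exists (facet_hyperplane d); split.
- exact: measurable_facet_hyperplane.
- exact: facet_hyperplane_null.
move=> x /= xF; apply: contrapT => xH; apply: xF => _.
rewrite patchE /H indicE.
have [xo|xo] := boolP (x \in orthant); last first.
  rewrite mulr0 mul0r ifF//; apply/negbTE; apply: contra xo.
  by rewrite !inE => -[].
rewrite mulr1 /pospow; move: xo; rewrite inE => xo.
have x1 : l1norm x != 1.
  by apply/eqP => e; apply: xH; rewrite /facet_hyperplane/= -l1norm_orthant.
case: ifPn => [|xS].
  rewrite inE => -[_]; rewrite le_eqVlt eq_sym subr_eq0 eq_sym (negbTE x1)/=.
  by move=> ->.
rewrite ifF ?mulr0//; apply/negbTE/negP => H1; move: xS.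
by apply/negP; rewrite negbK inE; split => //; exact: ltW.
Qed.
End simplex_integral.
End simplex_measure.

(** * The moment identity for the weights *)

Section weight_moments.
Variables (R : realType) (d : nat).
Hypothesis d_gt0 : (0 < d)%N.
Variable w : simplex_weight R d.
Hypothesis hw : nonneg_parameters w.
Local Notation leb := lebesgue_measure.

Definition weight_beta : R := facet_exponent w + 1.
(** This number is [lambda + 1]. *)
Definition weight_gamma : R := d%:R + homogeneous_degree w + weight_beta.

Lemma weight_beta_gt0 : 0 < weight_beta.
Proof. by have := facet_exponent_ge hw; rewrite /weight_beta; lra. Qed.

Let dh0 : 0 < d%:R + homogeneous_degree w.
Proof.
have := homogeneous_degree_ge hw.
have : 0 < d%:R :> R by rewrite ltr0n.
lra.
Qed.

Lemma weight_gamma_gt0 : 0 < weight_gamma.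
Proof. by rewrite addr_gt0// weight_beta_gt0. Qed.

Section homogeneous.
Variables (P : 'rV[R]_d -> R) (n : nat).
Hypotheses (mP : measurable_fun [set: 'rV[R]_d] P) (P0 : forall x, 0 <= P x).
Hypothesis PZ : forall r x, 0 < r -> P (r *: x) = r ^+ n * P x.

Let Q x := P x * homogeneous_part w x.
Let mQ : measurable_fun [set: 'rV[R]_d] Q.
Proof. by apply: measurable_funM => //; exact: measurable_homogeneous_part. Qed.
Let Q0 x : 0 <= Q x.
Proof. by rewrite mulr_ge0// homogeneous_part_ge0. Qed.

Let H x := Q x * \1_(@orthant R d) x.

Let mH : measurable_fun [set: 'rV[R]_d] H.
Proof.
by apply: measurable_funM => //; apply: measurable_indic; exact: measurable_orthant.
Qed.

Let H0 x : 0 <= H x. Proof. by rewrite mulr_ge0. Qed.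

Let HZ r x : 0 < r -> H (r *: x) = r `^ (n%:R + homogeneous_degree w) * H x.
Proof.
move=> r0; rewrite /H !indicE.
have -> : (r *: x \in @orthant R d) = (x \in @orthant R d).
  apply/idP/idP; rewrite !inE => xo i; have := xo i; rewrite mxE; last first.
    by move=> xi; rewrite mulr_ge0// ltW.
  by rewrite pmulr_rge0.
have [|_] := boolP (x \in _); last by rewrite !mulr0.
rewrite inE !mulr1 /Q => xo; rewrite PZ// homogeneous_partZ//.
rewrite powRD; last by rewrite (gt_eqF r0) implybT.
by rewrite powR_mulrn ?ltW//; ring.
Qed.

Lemma weighted_integral_beta : weighted_integral w P = beta_moment H (facet_exponent w).
Proof.
rewrite /weighted_integral -simplex_integralE//.
by apply: eq_integral => x _; rewrite weightE /Q mulrA.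
Qed.

Lemma weighted_integral_facet :
  weighted_integral w (fun x => (1 - l1norm x) * P x) = beta_moment H (facet_exponent w + 1).
Proof.
rewrite /weighted_integral -simplex_integralE//.
apply: eq_integral => x; rewrite inE => -[_ x1]; congr EFin.
rewrite weightE /Q -(mulr_powRB1 x1 weight_beta_gt0) /weight_beta addrK; ring.
Qed.

(** On the simplex a factor [1 - |x|] raises the exponent of the facet by one, so
this is the recursion between consecutive moments. *)
Lemma weighted_integral_homogeneous :
  weighted_integral w (fun x => (1 - l1norm x) * P x) =
  ((weight_beta / (n%:R + weight_gamma))%:E * weighted_integral w P)%E.
Proof.
have fb := facet_exponent_ge hw.
have n0 : 0 <= n%:R :> R by [].
rewrite weighted_integral_facet weighted_integral_beta (beta_moment_succ mH H0 HZ).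
- by congr ((_ / _)%:E * _)%E; rewrite /weight_gamma /weight_beta; ring.
- lra.
- have := dh0; lra.
Qed.

End homogeneous.

Lemma simplex_l1norm_le1 (x : 'rV[R]_d) : simplex x -> l1norm x <= 1.
Proof. by move=> [_]; rewrite subr_ge0. Qed.

(** By the moment identity it is enough to integrate [(1 - |x|) W].  Its exponent
on the facet is positive, and what remains is dominated by an integrable product
of functions of one variable on the cube. *)
Lemma weighted_integral1_fin : (weighted_integral w (fun=> 1%R) < +oo)%E.
Proof.
pose P (x : 'rV[R]_d) : R := 1.
have mP : measurable_fun [set: 'rV[R]_d] P by exact: measurable_cst.
have P0 x : 0 <= P x by rewrite /P ler01.
have PZ r x : 0 < r -> P (r *: x) = r ^+ 0 * P x by rewrite expr0 mulr1.
have E := weighted_integral_homogeneous mP P0 PZ.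
have c0 : 0 < weight_beta / (0%:R + weight_gamma).
  by rewrite divr_gt0 ?weight_beta_gt0// add0r weight_gamma_gt0.
suff : (weighted_integral w (fun x => (1 - l1norm x) * P x)%R < +oo)%E.
  rewrite E; case: (weighted_integral w P) => [r _| |_]; rewrite ?ltry ?ltNyr//.
  by rewrite gt0_muley ?lte_fin// ltxx.
pose g (u : R) := (1 + pospow (- 2^-1) u) * \1_(`[0, 1]%classic : set R) u.
have mg : measurable_fun [set: R] g.
  apply: measurable_funM; last exact: measurable_indic.
  by apply: measurable_funD => //; exact: measurable_pospow.
have g0 u : 0 <= g u by rewrite mulr_ge0// addr_ge0// pospow_ge0.
have goo : (\int[leb]_u (g u)%:E < +oo)%E.
  have m0 : measurable_fun [set: R] (fun u => (1 + pospow (- 2^-1) u)%:E).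
    by apply/measurable_EFinP; apply: measurable_funD => //; exact: measurable_pospow.
  rewrite (_ : (\int[leb]_u (g u)%:E)%E =
      (\int[leb]_(u in `]0%R, 1%R]) (1 + pospow (- 2^-1) u)%:E)%E); last first.
    rewrite integral_itv_obnd_cbnd; last exact: measurable_funTS.
    rewrite [RHS]integral_mkcond; apply: eq_integral => u _.
    by rewrite patchE /g indicE; case: ifP => _; rewrite ?mulr1 ?mulr0.
  under eq_integral do rewrite EFinD.
  rewrite ge0_integralD//; last 2 first.
  - by move=> u _; rewrite lee_fin pospow_ge0.
  - by apply/measurable_EFinP; apply: measurable_funTS; exact: measurable_pospow.
  under [X in (_ + X)%E]eq_integral do rewrite -[X in pospow _ X]subr0.
  rewrite integral_pospow//; last by lra.
  rewrite integral_cst//= lebesgue_measure_itv/= lte01.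
  by rewrite -EFinB mul1e -EFinD ltry.
apply: le_lt_trans (ge0_integral_prod d mg g0 goo).
rewrite weighted_integral_facet//.
have mh : measurable_fun [set: 'rV[R]_d] (homogeneous_part w) by exact: measurable_homogeneous_part.
have h0 := homogeneous_part_ge0 w.
have f0 := facet_exponent_ge hw.
apply: ge0_le_integral => //.
- by move=> x _; rewrite lee_fin mulr_ge0 ?pospow_ge0// !mulr_ge0.
- apply/measurable_EFinP; apply: measurable_funM.
    apply: measurable_funM; first exact: measurable_funM.
    by apply: measurable_indic; exact: measurable_orthant.
  apply: measurableT_comp (measurable_pospow _) _.
  by apply: measurable_funB => //; exact: measurable_l1norm.
- apply/measurable_EFinP; apply: measurable_prod => i _.
  exact: (measurableT_comp mg (measurable_coord i)).
move=> x _; rewrite lee_fin /P mul1r indicE.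
have [xo|_] := boolP (x \in @orthant R d); last first.
  by rewrite mulr0 mul0r; apply: prodr_ge0.
rewrite mulr1 /pospow subr_gt0.
have [x1|_] := ltP (l1norm x) 1; last by rewrite mulr0; apply: prodr_ge0.
rewrite inE in xo.
have xS : simplex x by split => //; rewrite subr_ge0 ltW.
have x01 i := simplex_coord i xS.
rewrite (eq_bigr (fun i => 1 + pospow (- 2^-1) (x ord0 i))); last first.
  by move=> i _; rewrite /g indicE mem_set ?mulr1//= in_itv/= x01.
rewrite -[leRHS]mulr1; apply: ler_pM => //; first exact: powR_ge0.
  exact: homogeneous_part_le.
have t1 : 1 - l1norm x <= 1 by have := l1norm_ge0 x; lra.
have t0 : 0 < 1 - l1norm x by rewrite subr_gt0.
rewrite -[leRHS](powRr0 (1 - l1norm x)); apply: ger_powR; first by rewrite t0.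
lra.
Qed.
End weight_moments.

(** * Square-integrable functions *)

Section weighted_L2.
Variables (R : realType) (d : nat) (w : simplex_weight R d).
Local Notation mu := (lebesgue_rV R d).
Local Notation S := (@simplex R d).
Implicit Types f g p q : 'rV[R]_d -> R.

Definition weighted_integrable f : Prop :=
  mu.-integrable S (fun x => (f x * weight w x)%:E).

Definition weighted_mean f : R := fine (weighted_integral w f).

Let mS : measurable S := @measurable_simplex R d.

Let mfW f : measurable_fun S f ->
  measurable_fun S (fun x => (f x * weight w x)%:E).
Proof.
move=> mf; apply/measurable_EFinP; apply: measurable_funM => //.
by apply: measurable_funTS; exact: measurable_weight.
Qed.

Lemma weighted_meanE f : weighted_integrable f ->
  weighted_integral w f = (weighted_mean f)%:E.
Proof. by move=> fi; rewrite fineK//; exact: integrable_fin_num. Qed.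

Lemma eq_weighted_integral f g : {in S, f =1 g} ->
  weighted_integral w f = weighted_integral w g.
Proof. by move=> fg; apply: eq_integral => x xS; rewrite fg. Qed.

Lemma eq_weighted_mean f g : {in S, f =1 g} -> weighted_mean f = weighted_mean g.
Proof. by move=> fg; rewrite /weighted_mean (eq_weighted_integral fg). Qed.

Lemma eq_weighted_integrable f g : {in S, f =1 g} ->
  weighted_integrable f -> weighted_integrable g.
Proof. by move=> fg; apply: eq_integrable => // x xS; rewrite fg. Qed.

Lemma weighted_integrableD f g : weighted_integrable f -> weighted_integrable g ->
  weighted_integrable (f \+ g).
Proof.
move=> fi gi; have := integrableD mS fi gi.
by apply: eq_integrable => // x _; rewrite /= -EFinD mulrDl.
Qed.

Lemma weighted_integrableZ a f : weighted_integrable f ->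
  weighted_integrable (fun x => a * f x).
Proof.
move=> fi; have := integrableZl mS a fi.
by apply: eq_integrable => // x _; rewrite -EFinM mulrA.
Qed.

Lemma weighted_meanD f g : weighted_integrable f -> weighted_integrable g ->
  weighted_mean (f \+ g) = weighted_mean f + weighted_mean g.
Proof.
move=> fi gi; apply: EFin_inj; rewrite EFinD -!weighted_meanE//; last first.
  exact: weighted_integrableD.
rewrite /weighted_integral -integralD//.
by apply: eq_integral => x _; rewrite -EFinD mulrDl.
Qed.

Lemma weighted_meanZ a f : weighted_integrable f ->
  weighted_mean (fun x => a * f x) = a * weighted_mean f.
Proof.
move=> fi; apply: EFin_inj; rewrite EFinM -!weighted_meanE//; last first.
  exact: weighted_integrableZ.
rewrite /weighted_integral -integralZl//.
by apply: eq_integral => x _; rewrite -EFinM mulrA.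
Qed.

Lemma weighted_mean_ge0 f : (forall x, S x -> 0 <= f x) -> 0 <= weighted_mean f.
Proof.
move=> f0; apply: fine_ge0; apply: integral_ge0 => x Sx.
by rewrite lee_fin mulr_ge0 ?weight_ge0// f0.
Qed.

Lemma le_weighted_mean f g : weighted_integrable f -> weighted_integrable g ->
  (forall x, S x -> f x <= g x) -> weighted_mean f <= weighted_mean g.
Proof.
move=> fi gi fg; rewrite -lee_fin -!weighted_meanE//.
apply: le_integral => // x; rewrite inE => Sx.
by rewrite lee_fin ler_wpM2r ?weight_ge0// fg.
Qed.

Lemma le_weighted_integrable f g : measurable_fun S f ->
  (forall x, S x -> `|f x| <= g x) -> weighted_integrable g -> weighted_integrable f.
Proof.
move=> mf fg; apply: le_integrable => //; first exact: mfW.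
move=> x Sx; rewrite lee_fin !normrM (ger0_norm (weight_ge0 _ _)).
rewrite ler_wpM2r ?weight_ge0//; apply: (le_trans (fg _ Sx)); exact: ler_norm.
Qed.

Lemma ge0_weighted_integrable f : measurable_fun S f -> (forall x, S x -> 0 <= f x) ->
  (weighted_integral w f < +oo)%E -> weighted_integrable f.
Proof.
move=> mf f0 foo; apply/integrableP; split; first exact: mfW.
rewrite (eq_integral (fun x => (f x * weight w x)%:E))// => x; rewrite inE => Sx.
by rewrite gee0_abs// lee_fin mulr_ge0 ?weight_ge0// f0.
Qed.

Lemma L2_simplexP f : L2_simplex w f <->
  measurable_fun S f /\ weighted_integrable (fun x => f x * f x).
Proof.
split=> -[mf fi]; split => //.
  apply: ge0_weighted_integrable => [|x _|]; first exact: measurable_funM.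
    by rewrite -expr2 sqr_ge0.
  by rewrite (eq_weighted_integral (g := fun x => `|f x| ^+ 2))// => x _; rewrite real_normK ?num_real.
rewrite (eq_weighted_integral (g := fun x => f x * f x)) ?weighted_meanE ?ltry//.
by move=> x _; rewrite real_normK ?num_real.
Qed.

Lemma L2_simplexM f g : L2_simplex w f -> L2_simplex w g ->
  weighted_integrable (fun x => f x * g x).
Proof.
move=> /L2_simplexP[mf fi] /L2_simplexP[mg gi].
apply: (le_weighted_integrable (g := (fun x => f x * f x) \+ (fun x => g x * g x))).
- exact: measurable_funM.
- move=> x _ /=; rewrite normrM.
  have := sqr_ge0 (`|f x| - `|g x|).
  rewrite -[f x * f x]expr2 -[g x * g x]expr2 -[f x ^+ 2]real_normK ?num_real//.
  rewrite -[g x ^+ 2]real_normK ?num_real//.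
  have := normr_ge0 (f x); have := normr_ge0 (g x); nra.
- exact: weighted_integrableD.
Qed.

Lemma L2_simplex_lin a f g : L2_simplex w f -> L2_simplex w g ->
  L2_simplex w (fun x => a * f x + g x).
Proof.
move=> fL gL; have [mf fi] := (L2_simplexP f).1 fL; have [mg gi] := (L2_simplexP g).1 gL.
have fg := L2_simplexM fL gL.
apply/L2_simplexP; split.
  by apply: measurable_funD => //; exact: measurable_funM.
have := weighted_integrableD (weighted_integrableZ (a ^+ 2) fi)
  (weighted_integrableD (weighted_integrableZ (2 * a) fg) gi).
by apply: eq_weighted_integrable => x _ /=; ring.
Qed.

Hypotheses (d_gt0 : (0 < d)%N) (hw : nonneg_parameters w).

Lemma bounded_weighted_integrable f (M : R) : measurable_fun S f ->
  (forall x, S x -> `|f x| <= M) -> weighted_integrable f.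
Proof.
move=> mf fM; apply: (le_weighted_integrable (g := fun x => M * 1)) => //.
  by move=> x /fM; rewrite mulr1.
apply: weighted_integrableZ; apply: ge0_weighted_integrable => //.
exact: weighted_integral1_fin.
Qed.

Lemma bounded_L2_simplex f (M : R) : measurable_fun S f ->
  (forall x, S x -> `|f x| <= M) -> L2_simplex w f.
Proof.
move=> mf fM; apply/L2_simplexP; split => //.
apply: (bounded_weighted_integrable (M := M * M)); first exact: measurable_funM.
by move=> x Sx; rewrite normrM; apply: ler_pM => //; exact: fM.
Qed.
End weighted_L2.

(** * The Heisenberg inequality for sums of orthogonal blocks *)

Lemma discriminant_le (R : realFieldType) (a b c : R) : 0 <= c ->
  (forall r, 0 <= a + 2 * r * b + r ^+ 2 * c) -> b ^+ 2 <= a * c.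
Proof.
rewrite le_eqVlt => /predU1P[<- H|c0 H].
  have [->|b0] := eqVneq b 0; first by rewrite mulr0 expr0n.
  have := H (- (a + 1) / (2 * b)).
  have -> : a + 2 * (- (a + 1) / (2 * b)) * b + (- (a + 1) / (2 * b)) ^+ 2 * 0 = -1.
    by field.
  by rewrite oppr_ge0 ler10.
have := H (- b / c).
have -> : a + 2 * (- b / c) * b + (- b / c) ^+ 2 * c = (a * c - b ^+ 2) / c.
  by field; rewrite gt_eqF.
by rewrite pmulr_lge0 ?invr_gt0// subr_ge0.
Qed.

Section euler.
Variables (R : realFieldType) (A : comAlgType R).
Variables (Phi : {scalar A}) (X : {linear A -> A}) (t : A).
Variable F : nat -> A -> Prop.
Variables (beta gamma : R).
Hypothesis XM : forall p q, X (p * q) = X p * q + p * X q.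
Hypothesis Xt : X t = t - 1.
Hypothesis F_lin : forall n p q, F n p -> F n q -> F n (p + q).
Hypothesis F_muln : forall n p k, F n p -> F n (p *+ k).
Hypothesis F_le : forall m n p, (m <= n)%N -> F m p -> F n p.
Hypothesis F_X : forall n p, F n.+1 p -> F n (X p - p *+ n).
Hypothesis F_t : forall n p, F n p -> F n.+1 (t * p).
Hypothesis parts : forall p, Phi (t * X p) = beta * Phi p - gamma * Phi (t * p).
Hypothesis beta_gt0 : 0 < beta.
Hypothesis gamma_gt0 : 0 < gamma.
Hypothesis tpos : forall p, 0 <= Phi (t * (p * p)).
Hypothesis tle : forall p, Phi (t * (p * p)) <= Phi (p * p).

Definition ortho_block n p := F n.+1 p /\ forall q, F n q -> Phi (p * q) = 0.

Definition energy p q := Phi (t * (X p * X q)).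

Let energyC p q : energy p q = energy q p.
Proof. by rewrite /energy [X p * _]mulrC. Qed.

Let Phi_mulX p : Phi (t * (p * X p)) = (beta * Phi (p * p) - gamma * Phi (t * (p * p))) / 2.
Proof.
have := parts (p * p); rewrite XM.
have -> : t * (X p * p + p * X p) = (t * (p * X p)) *+ 2 by ring.
by rewrite raddfMn/= => <-; rewrite -[X in X / _]mulr_natr mulfK.
Qed.

(** The remainder [r = X p - n p] has degree less than [n], hence is orthogonal to
[p], and [X (t r) - n t r] is orthogonal to [p] for the same reason.  These two
relations and integration by parts determine all the terms of the energy. *)
Lemma energy_block n p : ortho_block n p ->
  energy p p = Phi (t * (p * p)) * (n%:R * (n%:R - 1 + gamma) + gamma * (gamma - 1) / 2)
             + beta * (1 - gamma) / 2 * Phi (p * p).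
Proof.
move=> [Fp op].
pose r := X p - p *+ n.
have Fr : F n r by exact: F_X.
have Xp : X p = p *+ n + r by rewrite addrC subrK.
have pr : Phi (p * r) = 0 by exact: op.
have pXp : Phi (p * X p) = n%:R * Phi (p * p).
  by rewrite Xp mulrDr raddfD/= pr addr0 mulrnAr raddfMn/= mulr_natl.
have tpr : Phi (p * (t * r)) = Phi (t * (p * X p)) - n%:R * Phi (t * (p * p)).
  rewrite Xp.
  have -> : t * (p * (p *+ n + r)) = (t * (p * p)) *+ n + p * (t * r) by ring.
  by rewrite raddfD raddfMn/= mulr_natl addrAC subrr add0r.
have tpXr : Phi (t * (p * X r)) = (n%:R - 1) * Phi (p * (t * r)).
  have /op : F n (X (t * r) - (t * r) *+ n) by apply: F_X; exact: F_t.
  rewrite XM Xt.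
  have -> : p * ((t - 1) * r + t * X r - t * r *+ n) =
    p * (t * r) - p * r + t * (p * X r) - (p * (t * r)) *+ n by ring.
  rewrite raddfB raddfD raddfB raddfMn/= pr -[_ *+ n]mulr_natl; lra.
have := parts (p * X p); rewrite XM.
have -> : X (X p) = X p *+ n + X r by rewrite {1}Xp raddfD raddfMn.
have -> : t * (X p * X p + p * (X p *+ n + X r)) =
  t * (X p * X p) + (t * (p * X p)) *+ n + t * (p * X r) by ring.
rewrite 2!raddfD raddfMn/= tpXr tpr pXp !Phi_mulX -/(energy p p) -[_ *+ n]mulr_natl => E.
set u := Phi (p * p) in E *; set v := Phi (t * (p * p)) in E *.
set e := energy p p in E *.
have -> : e = beta * (n%:R * u) - gamma * ((beta * u - gamma * v) / 2) - n%:R * ((beta * u - gamma * v) / 2) - (n%:R - 1) * ((beta * u - gamma * v) / 2 - n%:R * v) by rewrite -E; ring.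
by field.
Qed.

Lemma energy_block_le n p : ortho_block n p ->
  energy p p <= (n%:R ^+ 2 + n%:R * gamma + gamma ^+ 2 / 2 + beta / 2) * Phi (p * p).
Proof.
move=> bp; rewrite (energy_block bp).
have := tpos p; have := tle p.
set u := Phi (p * p); set v := Phi (t * (p * p)) => vu v0.
have u0 : 0 <= u := le_trans v0 vu.
have n0 : 0 <= n%:R :> R by [].
set k := n%:R in n0 *.
apply: (@le_trans _ _ (v * (k ^+ 2 + k * gamma + gamma ^+ 2 / 2) + beta / 2 * u)).
  apply: lerD.
    apply: ler_wpM2l => //; have := gamma_gt0; nra.
  apply: ler_wpM2r => //.
  have := mulr_gt0 beta_gt0 gamma_gt0; lra.
rewrite [leRHS]mulrDl lerD2r mulrC; apply: ler_wpM2l => //.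
by rewrite !addr_ge0// ?exprn_ge0// ?divr_ge0// ?exprn_ge0// ?mulr_ge0// ltW.
Qed.

Let F_iterX n p : F n.+1 p -> F n.+1 (X p).
Proof.
move=> Fp; rewrite -(subrK (p *+ n) (X p)); apply: F_lin; last exact: F_muln.
by apply: (@F_le n) => //; exact: F_X.
Qed.

(** Integration by parts moves both derivatives onto [p] and produces polynomials
of degree at most [m + 1 < n], to which [q] is orthogonal. *)
Lemma energy_ortho m n p q : ortho_block m p -> ortho_block n q ->
  (m.+1 < n)%N -> energy p q = 0.
Proof.
move=> [Fp _] [_ oq] mn; have F1 := F_iterX Fp.
have := parts (q * X p); rewrite XM.
have -> : t * (X q * X p + q * X (X p)) = t * (X p * X q) + q * (t * X (X p)) by ring.
rewrite raddfD/= -/(energy p q).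
have -> : t * (q * X p) = q * (t * X p) by ring.
have H1 : F n (X p) by apply: (F_le _ F1); exact: ltnW.
have H2 : F n (t * X p) by apply: (F_le _ (F_t F1)).
have H3 : F n (t * X (X p)) by apply: (F_le _ (F_t (F_iterX F1))).
by rewrite (oq _ H1) (oq _ H2) (oq _ H3) !mulr0 subr0 addr0.
Qed.

Let energyDl p q r : energy (p + q) r = energy p r + energy q r.
Proof. by rewrite /energy raddfD/= mulrDl mulrDr raddfD. Qed.

Let energyDr p q r : energy r (p + q) = energy r p + energy r q.
Proof. by rewrite energyC energyDl !(energyC _ r). Qed.

Let energy0l r : energy 0 r = 0.
Proof. by rewrite /energy raddf0 mul0r mulr0 raddf0. Qed.

Let energy0r r : energy r 0 = 0.
Proof. by rewrite energyC energy0l. Qed.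

Let energyNl p r : energy (- p) r = - energy p r.
Proof. by rewrite /energy raddfN mulNr mulrN raddfN. Qed.

Let energyNr p r : energy r (- p) = - energy r p.
Proof. by rewrite energyC energyNl energyC. Qed.

Let energy_ge0 p : 0 <= energy p p.
Proof. exact: tpos. Qed.

Variables (P : nat -> A) (N : nat).
Hypothesis blocks : forall n, ortho_block n (P n).
Hypothesis P0 : Phi (P 0 * P 0) = 0.

Let S := \sum_(n < N) P n.
Let E := \sum_(n < N) n%:R ^+ 2 * Phi (P n * P n).

(** Distinct indices of equal parity differ by at least 2. *)
Lemma energy_parity_class (b : bool) :
  energy (\sum_(n < N | odd n == b) P n) (\sum_(n < N | odd n == b) P n) =
  \sum_(n < N | odd n == b) energy (P n) (P n).
Proof.
rewrite (big_morph (energy ^~ _) (fun p q => energyDl p q _) (energy0l _)).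
apply: eq_bigr => i ib.
rewrite (big_morph (energy (P i)) (fun p q => energyDr p q _) (energy0r _)).
rewrite (bigD1 i)//= big1 ?addr0// => j /andP[jb ji].
have [ij|ij|/val_inj ij] := ltngtP i j; last by rewrite ij eqxx in ji.
  apply: (energy_ortho (blocks i) (blocks j)).
  rewrite ltn_neqAle ij andbT; apply/eqP => e.
  by move: jb; rewrite -e/= (eqP ib); case: (b).
rewrite energyC; apply: (energy_ortho (blocks j) (blocks i)).
rewrite ltn_neqAle ij andbT; apply/eqP => e.
by move: ib; rewrite -e/= (eqP jb); case: (b).
Qed.

(** The parallelogram inequality for the even and the odd part of the sum. *)
Lemma energy_sum_le : energy S S <= 2 * \sum_(n < N) energy (P n) (P n).
Proof.
have parity (f : nat -> A) : \sum_(n < N) f n =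
    \sum_(n < N | odd n == true) f n + \sum_(n < N | odd n == false) f n.
  rewrite (bigID (fun n : 'I_N => odd n == true))/=; congr (_ + _).
  by apply: eq_bigl => i; rewrite eqb_id eqbF_neg.
have parityR (f : nat -> R) : \sum_(n < N) f n =
    \sum_(n < N | odd n == true) f n + \sum_(n < N | odd n == false) f n.
  rewrite (bigID (fun n : 'I_N => odd n == true))/=; congr (_ + _).
  by apply: eq_bigl => i; rewrite eqb_id eqbF_neg.
rewrite (parityR (fun n => energy (P n) (P n))) -2!energy_parity_class /S parity.
set p := \sum_(n < N | _) _; set q := \sum_(n < N | _) _.
have := energy_ge0 (p - q).
rewrite !(energyDl, energyDr, energyNl, energyNr) (energyC q p); lra.
Qed.

Let Phi_sum_sq : Phi (S * S) = \sum_(n < N) Phi (P n * P n).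
Proof.
have ortho i j : (i < j)%N -> Phi (P i * P j) = 0.
  move=> ij; rewrite mulrC; apply: (blocks j).2.
  by apply: F_le (blocks i).1.
rewrite /S mulr_suml raddf_sum; apply: eq_bigr => i _ /=.
rewrite mulr_sumr raddf_sum (bigD1 i)//= big1 ?addr0// => j ji.
have [ij|ij|/val_inj ij] := ltngtP i j; last by rewrite ij eqxx in ji.
  exact: ortho.
by rewrite mulrC ortho.
Qed.

Let Phi_sq_ge0 p : 0 <= Phi (p * p).
Proof. exact: le_trans (tpos p) (tle p). Qed.

(** With [S] the sum of the blocks, integration by parts for [S^2] and the
Cauchy-Schwarz inequality for the form [Phi (t * (p * q))].  The assumption on
[P 0] gives [Phi (S^2) <= E], which absorbs the term [gamma * Phi (t * S^2)]. *)
Lemma heisenberg_blocks :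
  (beta * Phi (S * S)) ^+ 2 <=
  (16 * (1 + gamma + gamma ^+ 2 + beta) + 2 * gamma ^+ 2) * Phi (t * (S * S)) * E.
Proof.
pose c := 1 + gamma + gamma ^+ 2 + beta.
have g0 := ltW gamma_gt0; have b0 := ltW beta_gt0.
have E0 : 0 <= E by apply: sumr_ge0 => n _; rewrite mulr_ge0// exprn_ge0.
have SE : Phi (S * S) <= E.
  rewrite Phi_sum_sq; apply: ler_sum => -[[|n] hn] _ /=; first by rewrite P0 mulr0.
  rewrite -[leLHS]mul1r; apply: ler_wpM2r => //.
  by rewrite expr_ge1// ler1n.
have DE : energy S S <= 2 * c * E.
  apply: (le_trans energy_sum_le); rewrite -mulrA ler_pM2l// mulr_sumr.
  apply: ler_sum => -[[|n] hn] _ /=.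
    by apply: (le_trans (energy_block_le (blocks 0))); rewrite P0 !mulr0.
  apply: (le_trans (energy_block_le (blocks n.+1))).
  rewrite mulrA; apply: ler_wpM2r => //.
  have n1 : 1 <= n.+1%:R :> R by rewrite ler1n.
  set k := n.+1%:R in n1 *.
  have k2 : k <= k ^+ 2 by rewrite expr2 ler_peMl//; lra.
  have k3 : 1 <= k ^+ 2 by apply: le_trans k2.
  have g2 : 0 <= gamma ^+ 2 by rewrite exprn_ge0.
  have h1 : k * gamma <= gamma * k ^+ 2 by rewrite mulrC ler_wpM2l.
  have h2 : gamma ^+ 2 * 1 <= gamma ^+ 2 * k ^+ 2 by rewrite ler_wpM2l.
  have h3 : beta * 1 <= beta * k ^+ 2 by rewrite ler_wpM2l.
  rewrite /c !mulrDl mul1r; lra.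
have CS : Phi (t * (S * X S)) ^+ 2 <= Phi (t * (S * S)) * energy S S.
  apply: discriminant_le; first exact: tpos.
  move=> r.
  have := tpos (S + r *: X S); rewrite -mulr_algl.
  have -> : t * ((S + r%:A * X S) * (S + r%:A * X S)) = t * (S * S) +
      (r%:A * (t * (S * X S))) *+ 2 + r%:A * (r%:A * (t * (X S * X S))) by ring.
  rewrite !mulr_algl 2!raddfD raddfMn/= !linearZ/= /energy => H.
  by apply: (le_trans H); rewrite le_eqVlt; apply/orP; left; apply/eqP; ring.
have := parts (S * S); rewrite XM.
have -> : t * (X S * S + S * X S) = (t * (S * X S)) *+ 2 by ring.
rewrite raddfMn/= -[_ *+ 2]mulr_natl => Eq.
have -> : beta * Phi (S * S) = 2 * Phi (t * (S * X S)) + gamma * Phi (t * (S * S)) by lra.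
have T0 := tpos S; have T1 := tle S.
set T := Phi (t * (S * S)) in CS T0 T1 *.
set x := Phi (t * (S * X S)) in CS *.
have TT : T ^+ 2 <= T * E by rewrite expr2 ler_wpM2l// (le_trans T1).
have h1 : x ^+ 2 <= T * (2 * c * E) by apply: (le_trans CS); exact: ler_wpM2l.
have h2 : gamma ^+ 2 * T ^+ 2 <= gamma ^+ 2 * (T * E) by apply: ler_wpM2l => //; exact: exprn_ge0.
have h3 : (2 * x + gamma * T) ^+ 2 <= 8 * x ^+ 2 + 2 * (gamma ^+ 2 * T ^+ 2).
  have := sqr_ge0 (2 * x - gamma * T); nra.
apply: (le_trans h3).
rewrite -/c.
have -> : (16 * c + 2 * gamma ^+ 2) * T * E = 8 * (T * (2 * c * E)) + 2 * (gamma ^+ 2 * (T * E)) by ring.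
lra.
Qed.
End euler.

(** * The Euler operator on polynomials *)

Section polynomials.
Variables (R : realType) (d : nat).
Local Notation poly := (mpoly d R).
Implicit Types (P Q : poly) (m : multinom d).

Definition peval P : 'rV[R]_d -> R := fun x => meval (x ord0) P.

Lemma measurable_peval P : measurable_fun [set: 'rV[R]_d] (peval P).
Proof.
rewrite (_ : peval P = fun x => \sum_(m <- msupp P) mcoeff m P * \prod_i x ord0 i ^+ m i); last first.
  by apply/funext => x; exact: mevalE.
apply: measurable_sum => m; apply: measurable_funM => //.
apply: measurable_prod => i _; apply: measurable_funX; exact: measurable_coord.
Qed.

Lemma peval_bounded P : exists M : R, forall x, @simplex R d x -> `|peval P x| <= M.
Proof.
exists (\sum_(m <- msupp P) `|mcoeff m P|) => x Sx.
rewrite /peval mevalE; apply: (le_trans (ler_norm_sum _ _ _)).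
apply: ler_sum => m _; rewrite normrM -[leRHS]mulr1 ler_wpM2l//.
rewrite normr_prod; apply: prodr_ile1 => i _; rewrite normr_ge0/=.
rewrite normrX; have /andP[x0 x1] := simplex_coord i Sx.
by rewrite ger0_norm// exprn_ile1.
Qed.

Definition euler P : poly := \sum_(i < d) mpolyX R (mnm1 i) * mderiv i P.

Lemma euler_is_linear : linear euler.
Proof.
move=> a P Q; rewrite /euler scaler_sumr -big_split; apply: eq_bigr => i _ /=.
by rewrite linearP/= mulrDr scalerAr.
Qed.

HB.instance Definition _ := GRing.isLinear.Build R poly poly *:%R euler euler_is_linear.

Lemma eulerM P Q : euler (P * Q) = euler P * Q + P * euler Q.
Proof.
rewrite /euler mulr_suml mulr_sumr -big_split; apply: eq_bigr => i _ /=.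
by rewrite mderivM; ring.
Qed.

Lemma euler_monomial m : euler (mpolyX R m) = mpolyX R m *+ mdeg m.
Proof.
rewrite /euler mdegE -sumrMnr; apply: eq_bigr => i _.
rewrite mderivX -scalerAr -mpolyXD scaler_nat.
have [->|mi] := posnP (m i); first by rewrite !mulr0n.
by rewrite addmC submK// lep1mP -lt0n.
Qed.

Lemma mcoeff_euler m P : mcoeff m (euler P) = mcoeff m P *+ mdeg m.
Proof.
transitivity (\sum_(k <- msupp P) mcoeff m (mcoeff k P *: mpolyX R k) *+ mdeg m); last first.
  by rewrite sumrMnl -raddf_sum -mpolyE.
rewrite {1}(mpolyE P) [euler _]linear_sum [LHS]raddf_sum/=.
apply: eq_bigr => k _; rewrite linearZ/= euler_monomial !mcoeffZ mcoeffMn mcoeffX.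
by case: eqP => [->|_]; rewrite ?mul0rn ?mulr0 ?mul0rn// mulrnAr.
Qed.

Lemma msize_leP n P :
  reflect (forall m, (n <= mdeg m)%N -> mcoeff m P = 0) (msize P <= n)%N.
Proof.
apply: (iffP idP) => [Pn m nm|H].
  by apply/eqP; rewrite mcoeff_eq0; apply: msize_mdeg_ge; exact: leq_trans nm.
rewrite msizeE; apply/bigmax_leqP_seq => m mP _; rewrite ltnNge; apply/negP => nm.
by move: mP; rewrite mcoeff_msupp H// eqxx.
Qed.

(** The top homogeneous part of [P] is an eigenvector of the Euler operator for
the eigenvalue [n]. *)
Lemma msize_euler n P : (msize P <= n.+1)%N -> (msize (euler P - P *+ n) <= n)%N.
Proof.
move=> /msize_leP Pn; apply/msize_leP => m nm.
rewrite mcoeffB mcoeff_euler mcoeffMn.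
move: nm; rewrite leq_eqVlt => /predU1P[->|nm]; first by rewrite subrr.
by rewrite Pn// !mul0rn subrr.
Qed.

Definition facet_poly : poly := 1 - \sum_(i < d) mpolyX R (mnm1 i).

Lemma euler_facet_poly : euler facet_poly = facet_poly - 1.
Proof.
rewrite /facet_poly; set s := \sum_(i < d) _.
have -> : euler (1 - s) = euler 1 - euler s by exact: raddfB.
have -> : euler s = s.
  rewrite {1}/s; transitivity (\sum_(i < d) euler (mpolyX R (mnm1 i))).
    exact: linear_sum.
  by apply: eq_bigr => i _; rewrite euler_monomial mdeg1.
have -> : euler 1 = 0 by rewrite -mpolyX0 euler_monomial mdeg0 mulr0n.
by rewrite sub0r addrC addKr.
Qed.

Lemma msize_facet_polyM n P : (msize P <= n)%N -> (msize (facet_poly * P) <= n.+1)%N.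
Proof.
move=> Pn.
have t2 : (msize facet_poly <= 2)%N.
  apply: (leq_trans (msizeD_le _ _)); rewrite msizeN geq_max msize1/=.
  apply: (leq_trans (msize_sum _ _ _)).
  by apply/bigmax_leqP => i _; rewrite msizeX mdeg1.
have [->|t0] := eqVneq facet_poly 0; first by rewrite mul0r msize0.
have [->|P0] := eqVneq P 0; first by rewrite mulr0 msize0.
rewrite msizeM//; apply: (@leq_trans (2 + n).-1) => //.
by rewrite -!subn1 leq_sub2r// leq_add.
Qed.

Lemma peval_facet_poly x : @simplex R d x -> peval facet_poly x = 1 - l1norm x.
Proof.
move=> Sx; rewrite /peval mevalB meval1; congr (_ - _).
rewrite [meval _ _]raddf_sum/= /l1norm; apply: eq_bigr => i _.
by rewrite mevalXU ger0_norm//; case: Sx.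
Qed.
End polynomials.

(** * The Heisenberg inequality for polynomials *)

Section weighted_polynomials.
Variables (R : realType) (d : nat) (w : simplex_weight R d).
Hypotheses (d_gt0 : (0 < d)%N) (hw : nonneg_parameters w).
Local Notation poly := (mpoly d R).
Local Notation S := (@simplex R d).
Implicit Types (P Q : poly) (m : multinom d).

Definition poly_mean P : R := weighted_mean w (peval P).

Lemma L2_peval P : L2_simplex w (peval P).
Proof.
have [M PM] := peval_bounded P.
apply: (bounded_L2_simplex d_gt0 hw _ PM).
by apply: measurable_funTS; exact: measurable_peval.
Qed.

Lemma weighted_integrable_peval P : weighted_integrable w (peval P).
Proof.
have [M PM] := peval_bounded P.
apply: (bounded_weighted_integrable d_gt0 hw _ PM).
by apply: measurable_funTS; exact: measurable_peval.
Qed.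

Lemma poly_mean_is_linear : linear_for *%R poly_mean.
Proof.
have Pi := weighted_integrable_peval.
move=> a P Q; rewrite /poly_mean -(weighted_meanZ a (Pi P)).
rewrite -(weighted_meanD (weighted_integrableZ a (Pi P)) (Pi Q)).
by apply: eq_weighted_mean => x _; rewrite /peval mevalD mevalZ.
Qed.

Lemma poly_mean_monomial m :
  (mdeg m)%:R * poly_mean (facet_poly R d * mpolyX R m) =
  weight_beta w * poly_mean (mpolyX R m) -
  weight_gamma w * poly_mean (facet_poly R d * mpolyX R m).
Proof.
pose P (x : 'rV[R]_d) := `|peval (mpolyX R m) x|.
have mP : measurable_fun [set: 'rV[R]_d] P.
  by apply: measurableT_comp => //; exact: measurable_peval.
have PZ r x : 0 < r -> P (r *: x) = r ^+ mdeg m * P x.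
  move=> r0; rewrite /P /peval !mevalX.
  have -> : \prod_(i < d) (r *: x) ord0 i ^+ m i =
      r ^+ mdeg m * \prod_(i < d) x ord0 i ^+ m i.
    rewrite mdegE -prodrXr -big_split; apply: eq_bigr => i _.
    by rewrite mxE exprMn.
  by rewrite normrM ger0_norm// exprn_ge0// ltW.
have PE : {in S, peval (mpolyX R m) =1 P}.
  move=> x; rewrite inE => Sx; rewrite /P ger0_norm// /peval mevalX.
  by apply: prodr_ge0 => i _; rewrite exprn_ge0//; case: Sx.
have TE : {in S, peval (facet_poly R d * mpolyX R m) =1 (fun x => (1 - l1norm x) * P x)}.
  move=> x Sx; rewrite -PE// -peval_facet_poly; last by rewrite -inE.
  by rewrite /peval mevalM.
have := weighted_integral_homogeneous d_gt0 hw mP (fun x => normr_ge0 _) PZ.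
rewrite -(eq_weighted_integral _ TE) -(eq_weighted_integral _ PE).
rewrite !(weighted_meanE (weighted_integrable_peval _)) -EFinM => -[].
rewrite -/(poly_mean _) -/(poly_mean _) => E.
have g0 : 0 < (mdeg m)%:R + weight_gamma w.
  by rewrite ltr_wpDl// weight_gamma_gt0.
apply/eqP; rewrite eq_sym subr_eq -mulrDl {}E; apply/eqP; field.
by rewrite gt_eqF.
Qed.

(** By linearity this is the case of a monomial, for which it restates the moment
identity. *)
Lemma poly_mean_parts P :
  poly_mean (facet_poly R d * euler P) =
  weight_beta w * poly_mean P - weight_gamma w * poly_mean (facet_poly R d * P).
Proof.
pose Phi : {scalar poly} := HB.pack poly_mean (GRing.isLinear.Build R poly R *%R poly_mean poly_mean_is_linear).
have mZ a Q : poly_mean (a *: Q) = a * poly_mean Q by rewrite -[poly_mean]/(Phi : poly -> R) linearZ.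
have mS (f : multinom d -> poly) :
    poly_mean (\sum_(m <- msupp P) f m) = \sum_(m <- msupp P) poly_mean (f m).
  exact: (linear_sum Phi).
have eP : euler P = \sum_(m <- msupp P) mcoeff m P *: euler (mpolyX R m).
  rewrite {1}(mpolyE P); transitivity (\sum_(m <- msupp P) euler (mcoeff m P *: mpolyX R m)).
    exact: linear_sum.
  by apply: eq_bigr => m _; exact: linearZ.
have e1 : poly_mean P = \sum_(m <- msupp P) poly_mean (mcoeff m P *: mpolyX R m).
  by rewrite {1}(mpolyE P) mS.
have e2 : poly_mean (facet_poly R d * P) =
    \sum_(m <- msupp P) poly_mean (facet_poly R d * (mcoeff m P *: mpolyX R m)).
  by rewrite {1}(mpolyE P) mulr_sumr mS.
rewrite e1 e2 eP !mulr_sumr mS -sumrB; apply: eq_bigr => m _.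
rewrite euler_monomial -!scalerAr !mZ -[_ *+ mdeg m]scaler_nat -scalerAr mZ.
rewrite poly_mean_monomial; ring.
Qed.

Lemma poly_heisenberg (P : nat -> poly) N :
  (forall n, (msize (P n) <= n.+1)%N /\
     forall Q, (msize Q <= n)%N -> poly_mean (P n * Q) = 0) ->
  poly_mean (P 0 * P 0) = 0 ->
  let S := \sum_(n < N) P n in
  (weight_beta w * poly_mean (S * S)) ^+ 2 <=
  (16 * (1 + weight_gamma w + weight_gamma w ^+ 2 + weight_beta w) + 2 * weight_gamma w ^+ 2) *
  poly_mean (facet_poly R d * (S * S)) *
  \sum_(n < N) n%:R ^+ 2 * poly_mean (P n * P n).
Proof.
move=> blocks P0 /=.
pose Phi : {scalar poly} := HB.pack poly_mean (GRing.isLinear.Build R poly R *%R poly_mean poly_mean_is_linear).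
apply: (@heisenberg_blocks _ _ Phi (@euler R d) (facet_poly R d) (fun n P => (msize P <= n)%N)) => //.
- exact: eulerM.
- exact: euler_facet_poly.
- move=> n p q pn qn; apply: (leq_trans (msizeD_le _ _)).
  by rewrite geq_max pn.
- move=> n p k pn; rewrite -scaler_nat; exact: leq_trans (msizeZ_le _ _) pn.
- by move=> m n p mn pm; exact: leq_trans mn.
- exact: msize_euler.
- exact: msize_facet_polyM.
- exact: poly_mean_parts.
- exact: weight_beta_gt0.
- exact: weight_gamma_gt0.
- move=> p; apply: weighted_mean_ge0 => x Sx.
  rewrite /peval !mevalM -/(peval _ _) peval_facet_poly// mulr_ge0//.
    by case: Sx.
  by rewrite -expr2 sqr_ge0.
- move=> p; apply: le_weighted_mean; try exact: weighted_integrable_peval.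
  move=> x Sx; rewrite /peval [leLHS]mevalM -/(peval (facet_poly R d) x) peval_facet_poly//.
  rewrite ler_piMl//; last by have := l1norm_ge0 x; lra.
  by rewrite mevalM -expr2 sqr_ge0.
Qed.
End weighted_polynomials.

(** * Continuous functions on the simplex *)

Section modulus.
Variables (R : realType) (d : nat).
Local Notation S := (@simplex R d).

Lemma continuous_l1norm : continuous (@l1norm R d).
Proof.
apply: continuous_big => [|i _ x]; first exact: add_continuous.
by apply: continuous_comp; [exact: coord_continuous|exact: norm_continuous].
Qed.

Lemma compact_simplex : compact S.
Proof.
have cK : compact [set v : 'rV[R]_d | forall i, `[0, 1]%classic (v ord0 i)].
  by apply: (@rV_compact R d (fun=> `[0, 1]%classic)) => i; exact: segment_compact.
apply: (subclosed_compact _ cK); last first.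
  by move=> x Sx i; rewrite /= in_itv/=; exact: simplex_coord.
rewrite (_ : S = (\bigcap_(i in [set: 'I_d]) ((fun x : 'rV[R]_d => x ord0 i) @^-1` [set u | 0 <= u])) `&`
    (@l1norm R d @^-1` [set u | u <= 1])); last first.
  apply/seteqP; split => [x [x0 x1]|x [x0 x1]].
    by split; [move=> i _; exact: x0|rewrite /= -subr_ge0].
  by split; [move=> i; exact: (x0 i I)|rewrite subr_ge0].
apply: closedI.
  apply: closed_bigI => i _; apply: preimage_closed; last exact: closed_ge.
  by move=> x _; exact: coord_continuous.
apply: preimage_closed; last exact: closed_le.
by move=> x _; exact: continuous_l1norm.
Qed.

Lemma sqr_coord_le (x : 'rV[R]_d) : `|x| ^+ 2 <= \sum_(i < d) x ord0 i ^+ 2.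
Proof.
have [x0|x0] := eqVneq (mx_norm x) 0.
  have -> : `|x| = 0 by exact: x0.
  by rewrite expr0n; apply: sumr_ge0 => i _; rewrite sqr_ge0.
have [[j i] /= xi] := mx_norm_neq0 x0.
rewrite -[`|x|]/(mx_norm x) xi (ord1 j) real_normK ?num_real// (bigD1 i)//= lerDl.
by apply: sumr_ge0 => k _; rewrite sqr_ge0.
Qed.

Lemma continuous_simplex_bounded (f : 'rV[R]_d -> R) : {within S, continuous f} ->
  exists M : R, forall x, S x -> `|f x| <= M.
Proof.
move=> cf; have /compact_bounded[M [_ HM]] := continuous_compact cf compact_simplex.
exists (M + 1) => x Sx; apply: (HM (M + 1)); first by rewrite ltrDl.
by exists x.
Qed.

(** A quadratic modulus of continuity, as needed to estimate an average of [f] by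
a variance: distant points are handled by the bound on [f], close ones by
continuity, and compactness makes the constant uniform. *)
Lemma continuous_simplex_modulus (f : 'rV[R]_d -> R) e : {within S, continuous f} ->
  0 < e -> exists M : R, forall x y, S x -> S y ->
    `|f x - f y| <= e + M * \sum_(i < d) (x ord0 i - y ord0 i) ^+ 2.
Proof.
move=> cf e0; have [B fB] := continuous_simplex_bounded cf.
have /compact_near_coveringP cov := compact_simplex.
pose P (M : R) (x : 'rV[R]_d) := S x -> forall y, S y ->
    `|f x - f y| <= e + M * \sum_(i < d) (x ord0 i - y ord0 i) ^+ 2.
suff [M [_ HM]] : \forall M \near +oo, S `<=` P M.
  exists (M + 1) => x y Sx Sy; apply: (HM (M + 1)) => //.
  by rewrite ltrDl.
apply: cov => x Sx.
have /(_ _ Sx) := (subspace_continuousP S f).1 cf.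
move=> /cvgrPdist_lt /(_ (e / 2)); rewrite divr_gt0// => /(_ isT).
move=> /nbhs_ballP[r /= r0 Hr].
have r20 : 0 < r / 2 by rewrite divr_gt0.
exists (ball x (r / 2), [set M | 2 * B / (r / 2) ^+ 2 <= M]).
  split; first exact: nbhsx_ballx.
  exists (2 * B / (r / 2) ^+ 2); split => //; first exact: num_real.
  by move=> M /ltW.
move=> [x' M] /= [xx' HM] Sx' y Sy.
have sum0 : 0 <= \sum_(i < d) (x' ord0 i - y ord0 i) ^+ 2.
  by apply: sumr_ge0 => i _; rewrite sqr_ge0.
have fx' : `|f x - f x'| < e / 2.
  apply: Hr => //; apply: le_ball xx'; lra.
have B0 : 0 <= B by apply: le_trans (fB _ Sx).
have M0 : 0 <= M.
  by apply: le_trans HM; rewrite divr_ge0 ?exprn_ge0// ?mulr_ge0// ltW.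
have [yx|yx] := ltP `|x - y| r.
  have fy : `|f x - f y| < e / 2 by apply: Hr => //; rewrite /= -ball_normE.
  apply: (@le_trans _ _ e); last by rewrite lerDl mulr_ge0.
  rewrite (_ : f x' - f y = (f x - f y) - (f x - f x')); last by ring.
  by rewrite (le_trans (ler_normB _ _))//; lra.
have rx : r / 2 <= `|x' - y|.
  move: xx'; rewrite -ball_normE/= => xx'.
  have := ler_distD x' x y; lra.
have : (r / 2) ^+ 2 <= \sum_(i < d) (x' ord0 i - y ord0 i) ^+ 2.
  apply: (@le_trans _ _ (`|x' - y| ^+ 2)).
    by rewrite ler_pXn2r// nnegrE// ltW.
  apply: (le_trans (sqr_coord_le _)).
  by apply: ler_sum => i _; rewrite !mxE.
move=> rs; apply: (@le_trans _ _ (2 * B)).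
  by rewrite (le_trans (ler_normB _ _))// mulr2n mulrDl mul1r lerD// fB.
have H2 : 2 * B <= M * (r / 2) ^+ 2 by rewrite -ler_pdivrMr// exprn_gt0.
apply: (le_trans H2); apply: ler_wpDl; first exact: ltW.
exact: ler_wpM2l.
Qed.
End modulus.

(** * Second moments of product laws *)

Section product_law.
Variables (R : realFieldType) (T : finType) (p : T -> R) (N : nat).
Hypothesis p1 : \sum_a p a = 1.

Definition product_law (s : {ffun 'I_N -> T}) : R := \prod_j p (s j).

Lemma product_law_prod (g : 'I_N -> T -> R) :
  \sum_s product_law s * \prod_j g j (s j) = \prod_j \sum_a p a * g j a.
Proof.
by rewrite bigA_distr_bigA; apply: eq_bigr => s _; rewrite -big_split.
Qed.

Lemma product_law_sum1 : \sum_s product_law s = 1.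
Proof.
have := product_law_prod (fun=> fun=> 1).
rewrite [RHS]big1 => [|j _]; last first.
  by under eq_bigr do rewrite mulr1; exact: p1.
by move=> <-; apply: eq_bigr => s _; rewrite big1 ?mulr1.
Qed.

(** The variance of a sum of independent centred variables: the mixed terms
factor and vanish. *)
Lemma product_law_sqr_sum (c : T -> R) : \sum_a p a * c a = 0 ->
  \sum_s product_law s * (\sum_j c (s j)) ^+ 2 = N%:R * \sum_a p a * c a ^+ 2.
Proof.
move=> c0.
have E j k : \sum_s product_law s * (c (s j) * c (s k)) =
    if j == k then \sum_a p a * c a ^+ 2 else 0.
  pose g (l : 'I_N) a := (if l == j then c a else 1) * (if l == k then c a else 1).
  transitivity (\sum_s product_law s * \prod_l g l (s l)).
    apply: eq_bigr => s _; congr (_ * _); rewrite big_split/=.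
    by rewrite -!big_mkcond/= !big_pred1_eq.
  rewrite product_law_prod /g; have [<-|jk] := eqVneq j k.
    rewrite (bigD1 j)//= [X in _ * X]big1; last first.
      move=> l /negbTE lj; rewrite lj.
      by under eq_bigr do rewrite !mulr1; exact: p1.
    by rewrite eqxx mulr1; apply: eq_bigr => a _; rewrite -expr2.
  rewrite (bigD1 j)//= eqxx (negbTE jk).
  by under eq_bigr do rewrite mulr1; rewrite c0 mul0r.
under eq_bigr do rewrite expr2 mulr_suml mulr_sumr.
rewrite exchange_big/= (eq_bigr (fun=> \sum_a p a * c a ^+ 2)).
  by rewrite sumr_const card_ord mulr_natl.
move=> j _; under eq_bigr do rewrite mulr_sumr mulr_sumr.
rewrite exchange_big/=; under eq_bigr do rewrite E.
by rewrite -big_mkcond/= (big_pred1 j)// => k; rewrite eq_sym.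
Qed.
End product_law.

(** * Uniform approximation by Bernstein polynomials *)

Section bernstein.
Variables (R : realType) (d : nat).
Local Notation S := (@simplex R d).
Local Notation poly := (mpoly d R).

Definition barycentric (a : option 'I_d) : poly :=
  if a is Some i then mpolyX R (mnm1 i) else facet_poly R d.

(** The barycentre of [N] vertices of the simplex; [None] stands for the origin. *)
Definition empirical_point N (s : {ffun 'I_N -> option 'I_d}) : 'rV[R]_d :=
  \row_i ((\sum_(j < N) (s j == Some i)%:R) / N%:R).

(** At [x] this is the mean of [f] at the barycentre of [N] vertices drawn
independently, the probabilities being the barycentric coordinates of [x]. *)
Definition bernstein (f : 'rV[R]_d -> R) N : poly :=
  \sum_(s : {ffun 'I_N -> option 'I_d})
    f (empirical_point s) *: \prod_(j < N) barycentric (s j).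

Lemma big_option (F : option 'I_d -> R) : \sum_a F a = F None + \sum_i F (Some i).
Proof.
rewrite (bigD1 None)//=; congr (_ + _).
rewrite (reindex_omap Some id)/=; last by case.
by apply: eq_bigl => i; rewrite eqxx.
Qed.

Lemma barycentric_ge0 a x : S x -> 0 <= peval (barycentric a) x.
Proof.
move=> Sx; case: a => [i|] /=; first by rewrite /peval mevalXU; case: Sx.
by rewrite peval_facet_poly//; case: Sx.
Qed.

Lemma barycentric_sum1 x : \sum_a peval (barycentric a) x = 1.
Proof.
rewrite big_option /peval /= mevalB meval1 -[RHS](subrK (\sum_(i < d) x ord0 i)).
rewrite [meval _ (\sum_(i < d) _)]raddf_sum/=.
by congr (1 - _ + _); apply: eq_bigr => i _; rewrite mevalXU.
Qed.

Lemma empirical_point_simplex N (s : {ffun 'I_N.+1 -> option 'I_d}) :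
  S (empirical_point s).
Proof.
have E i : 0 <= empirical_point s ord0 i.
  by rewrite mxE divr_ge0// sumr_ge0.
split => //; rewrite subr_ge0 /l1norm.
under eq_bigr do rewrite ger0_norm// mxE.
rewrite -mulr_suml ler_pdivrMr// mul1r exchange_big/=.
rewrite -[leRHS]mulr1n.
apply: (@le_trans _ _ (\sum_(j < N.+1) 1)); last by rewrite sumr_const card_ord.
apply: ler_sum => j _; case: (s j) => [i|].
  rewrite (bigD1 i)//= eqxx big1 ?addr0// => k ki.
  by case: eqP => // -[ik]; rewrite ik eqxx in ki.
by rewrite big1.
Qed.

Lemma peval_bernstein f N x : peval (bernstein f N) x =
  \sum_s product_law (fun a => peval (barycentric a) x) s * f (empirical_point (s : {ffun 'I_N -> _})).
Proof.
rewrite /peval /bernstein raddf_sum/=; apply: eq_bigr => s _.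
by rewrite mevalZ rmorph_prod mulrC.
Qed.

Lemma bernstein_variance N x i : S x ->
  \sum_s product_law (fun a => peval (barycentric a) x) s *
    (x ord0 i - empirical_point (s : {ffun 'I_N.+1 -> _}) ord0 i) ^+ 2 <= N.+1%:R^-1.
Proof.
move=> Sx; pose p a := peval (barycentric a) x.
have p1 : \sum_a p a = 1 by exact: barycentric_sum1.
pose c (a : option 'I_d) : R := x ord0 i - (a == Some i)%:R.
have pi : p (Some i) = x ord0 i by rewrite /p /peval /= mevalXU.
have psum : \sum_a p a * (a == Some i)%:R = x ord0 i.
  rewrite (bigD1 (Some i))//= eqxx mulr1 big1 ?addr0// => a /negbTE ->.
  by rewrite mulr0.
have c0 : \sum_a p a * c a = 0.
  under eq_bigr do rewrite mulrBr.
  by rewrite sumrB psum -mulr_suml p1 mul1r subrr.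
have x01 := simplex_coord i Sx.
have c2 : \sum_a p a * c a ^+ 2 <= 1.
  rewrite -p1; apply: ler_sum => a _; rewrite ler_piMr ?barycentric_ge0//.
  by rewrite /c; case: (a == Some i) => /=; nra.
have := product_law_sqr_sum N.+1 p1 c0 => V.
have -> : \sum_s product_law p s * (x ord0 i - empirical_point (s : {ffun 'I_N.+1 -> _}) ord0 i) ^+ 2 =
   N.+1%:R ^- 2 * \sum_s product_law p s * (\sum_(j < N.+1) c (s j)) ^+ 2.
  rewrite mulr_sumr; apply: eq_bigr => s _; rewrite [RHS]mulrCA; congr (_ * _).
  rewrite /c sumrB sumr_const card_ord mxE -mulr_natl.
  by field.
rewrite V.
have -> : N.+1%:R ^- 2 * (N.+1%:R * \sum_a p a * c a ^+ 2) = N.+1%:R^-1 * \sum_a p a * c a ^+ 2.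
  by field.
by rewrite ler_piMr// invr_ge0.
Qed.

(** The law of large numbers: the barycentre has mean [x] and coordinates of
variance at most [1 / N], which the quadratic modulus of [f] converts into a
uniform estimate. *)
Lemma polynomial_approximation f e : {within S, continuous f} -> 0 < e ->
  exists P : poly, forall x, S x -> `|f x - peval P x| <= e.
Proof.
move=> cf e0.
have e2 : 0 < e / 2 by rewrite divr_gt0.
have [M HM] := continuous_simplex_modulus cf e2.
have [N HN] : exists N, `|M| * d%:R / N.+1%:R <= e / 2.
  have [N HN] := @ltr_add_invr R 0 (e / 2 / (`|M| * d%:R + 1)) ltac:(by rewrite divr_gt0// ltr_wpDl// mulr_ge0).
  exists N; move: HN; rewrite add0r ltr_pdivlMr ?ltr_wpDl// ?mulr_ge0// => HN.
  apply: le_trans (ltW HN); rewrite mulrC ler_wpM2l// ?invr_ge0//.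
  by rewrite lerDl.
exists (bernstein f N.+1) => x Sx; rewrite peval_bernstein.
pose p a := peval (barycentric a) x.
have p0 s : 0 <= product_law p (s : {ffun 'I_N.+1 -> _}).
  by apply: prodr_ge0 => j _; exact: barycentric_ge0.
have p1 := product_law_sum1 N.+1 (barycentric_sum1 x).
rewrite -[f x]mul1r -p1 mulr_suml -sumrB.
apply: (le_trans (ler_norm_sum _ _ _)).
apply: (@le_trans _ _ (\sum_s product_law p s * (e / 2 + `|M| * \sum_(i < d) (x ord0 i - empirical_point (s : {ffun 'I_N.+1 -> _}) ord0 i) ^+ 2))).
  apply: ler_sum => s _; rewrite -mulrBr normrM (ger0_norm (p0 s)) ler_wpM2l//.
  apply: (le_trans (HM _ _ Sx (empirical_point_simplex s))).
  rewrite lerD2l ler_wpM2r ?ler_norm//.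
  by apply: sumr_ge0 => i _; rewrite sqr_ge0.
under eq_bigr do rewrite mulrDr [X in _ + X]mulrCA.
rewrite big_split/= -mulr_suml p1 mul1r -mulr_sumr [leRHS](splitr e) lerD2l.
apply: le_trans HN; rewrite -mulrA ler_wpM2l//.
under eq_bigr do rewrite mulr_sumr.
rewrite exchange_big/= mulr_natl -[in leRHS](card_ord d) -sumr_const.
by apply: ler_sum => i _; exact: bernstein_variance.
Qed.

(** A continuous function on the simplex is a limit of polynomials, which are
measurable for the sigma-algebra generated by the coordinates. *)
Lemma measurable_continuous_simplex (f : 'rV[R]_d -> R) : {within S, continuous f} -> measurable_fun S f.
Proof.
move=> cf.
have /choice[P HP] : forall n : nat, exists P : poly, forall x, S x -> `|f x - peval P x| <= n.+1%:R^-1.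
  by move=> n; apply: polynomial_approximation.
apply: (measurable_fun_cvg (h := fun n => peval (P n))).
  by move=> n; apply: measurable_funTS; exact: measurable_peval.
move=> x Sx; apply/cvgrPdist_le => e e0.
near=> n; apply: (le_trans (HP n x Sx)); apply: ltW.
near: n; exact: near_infty_natSinv_lt (PosNum e0).
Unshelve. all: by end_near. Qed.
End bernstein.

(** * Orthogonal projections on polynomials *)

Section projections.
Variables (R : realType) (d : nat) (w : simplex_weight R d).
Hypotheses (d_gt0 : (0 < d)%N) (hw : nonneg_parameters w).
Local Notation poly := (mpoly d R).
Local Notation S := (@simplex R d).
Local Notation L2 := (L2_simplex w).
Implicit Types (f g h : 'rV[R]_d -> R) (P Q : poly) (m : multinom d).

Definition inner f g : R := weighted_mean w (fun x => f x * g x).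

Lemma innerC f g : inner f g = inner g f.
Proof. by apply: eq_weighted_mean => x _; rewrite mulrC. Qed.

Lemma inner_ge0 f : 0 <= inner f f.
Proof. by apply: weighted_mean_ge0 => x _; rewrite -expr2 sqr_ge0. Qed.

Lemma innerPl a f g h : L2 f -> L2 g -> L2 h ->
  inner (fun x => a * f x + g x) h = a * inner f h + inner g h.
Proof.
move=> fL gL hL; have fh := L2_simplexM fL hL; have gh := L2_simplexM gL hL.
rewrite -weighted_meanZ// -weighted_meanD//; last exact: weighted_integrableZ.
by apply: eq_weighted_mean => x _ /=; rewrite mulrDl mulrA.
Qed.

Lemma inner_residual f g P : L2 f -> L2 g ->
  inner f g = inner (fun x => f x - peval P x) g + inner (peval P) g.
Proof.
move=> fL gL; have PL := L2_peval d_gt0 hw P.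
rewrite -[X in X + _]mul1r -innerPl//.
  by apply: eq_weighted_mean => x _; rewrite mul1r subrK.
have -> : (fun x => f x - peval P x) = (fun x => -1 * peval P x + f x).
  by apply/funext => x; rewrite mulN1r addrC.
exact: L2_simplex_lin.
Qed.

Lemma L2_sub f P : L2 f -> L2 (fun x => f x - peval P x).
Proof.
move=> fL; have -> : (fun x => f x - peval P x) = (fun x => -1 * peval P x + f x).
  by apply/funext => x; rewrite mulN1r addrC.
exact: L2_simplex_lin (L2_peval d_gt0 hw P) fL.
Qed.

Lemma inner_sub f g P : L2 f -> L2 g ->
  inner (fun x => f x - peval P x) g = inner f g - inner (peval P) g.
Proof. by move=> fL gL; rewrite (inner_residual P fL gL) addrK. Qed.

Lemma inner_peval P Q : inner (peval P) (peval Q) = poly_mean w (P * Q).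
Proof. by apply: eq_weighted_mean => x _; rewrite /peval mevalM. Qed.

Lemma inner_pevalP f a P Q : L2 f ->
  inner f (peval (a *: P + Q)) = a * inner f (peval P) + inner f (peval Q).
Proof.
move=> fL; have PL := L2_peval d_gt0 hw.
rewrite innerC -!(innerC (peval _)) -innerPl//.
by apply: eq_weighted_mean => x _; rewrite /peval mevalD mevalZ.
Qed.

Lemma inner_cauchy_schwarz f g : L2 f -> L2 g ->
  inner f g ^+ 2 <= inner f f * inner g g.
Proof.
move=> fL gL; apply: discriminant_le; first exact: inner_ge0.
move=> r; have := inner_ge0 (fun x => r * g x + f x).
have hL := L2_simplex_lin r gL fL.
rewrite innerPl// !(innerC _ (fun x => r * g x + f x)) !innerPl// (innerC f g).
by move=> H; apply: (le_trans H); rewrite le_eqVlt; apply/orP; left; apply/eqP; ring.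
Qed.

Lemma inner_peval0 f : inner f (peval 0) = 0.
Proof.
rewrite /inner (eq_weighted_mean _ (g := fun=> 0)) => [|x _]; last by rewrite /peval meval0 mulr0.
rewrite /weighted_mean /weighted_integral integral0_eq// => x _.
by rewrite mul0r.
Qed.

Lemma inner_span_eq0 g (s : seq (multinom d)) P : L2 g ->
  (forall m, m \notin s -> mcoeff m P = 0) ->
  (forall m, m \in s -> inner g (peval (mpolyX R m)) = 0) -> inner g (peval P) = 0.
Proof.
move=> gL Ps gs; rewrite (mpolyE P).
have : {subset msupp P <= s}.
  by move=> m; rewrite mcoeff_msupp; apply: contraR => /Ps ->.
elim: (msupp P) => [|m l IH] ls; first by rewrite big_nil inner_peval0.
rewrite big_cons inner_pevalP// gs ?mulr0 ?add0r; last by rewrite ls ?mem_head.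
by apply: IH => k kl; rewrite ls// inE kl orbT.
Qed.

(** The Gram-Schmidt process.  If the new monomial is, up to a function [e] of
norm zero, a combination of the previous ones, then [e] is orthogonal to
everything by the Cauchy-Schwarz inequality and no correction is needed. *)
Lemma monomial_projection (s : seq (multinom d)) f : L2 f ->
  exists2 P, (forall m, m \notin s -> mcoeff m P = 0) &
    forall m, m \in s -> inner (fun x => f x - peval P x) (peval (mpolyX R m)) = 0.
Proof.
elim: s f => [|k s IH] f fL.
  by exists 0 => // m _; rewrite mcoeff0.
have [P Ps Po] := IH f fL.
have XL := L2_peval d_gt0 hw (mpolyX R k).
have [Q Qs Qo] := IH _ XL.
pose e := mpolyX R k - Q.
have eE : peval e = fun x => peval (mpolyX R k) x - peval Q x.
  by apply/funext => x; rewrite /peval mevalB.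
have eL : L2 (peval e) by exact: L2_peval.
have rL := L2_sub P fL.
have eo m : m \in s -> inner (peval e) (peval (mpolyX R m)) = 0.
  by move=> ms; rewrite eE Qo.
pose a := inner (fun x => f x - peval P x) (peval e) / inner (peval e) (peval e).
have resE x : f x - peval (a *: e + P) x = (f x - peval P x) - peval (a *: e) x.
  by rewrite /peval mevalD; ring.
have aE g : L2 g -> inner g (peval (a *: e)) = a * inner g (peval e).
  by move=> gL; rewrite -[a *: e]addr0 inner_pevalP// inner_peval0 addr0.
exists (a *: e + P) => [m|m].
  rewrite inE negb_or => /andP[mk ms].
  rewrite mcoeffD mcoeffZ mcoeffB mcoeffX Ps// Qs// subr0 addr0.
  by rewrite eq_sym (negbTE mk) mulr0.
rewrite (funext resE).
have old n : n \in s -> inner (fun x => f x - peval P x - peval (a *: e) x) (peval (mpolyX R n)) = 0.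
  move=> ns; have XnL := L2_peval d_gt0 hw (mpolyX R n).
  rewrite inner_sub// Po// sub0r innerC aE// innerC eo// mulr0 oppr0 //.
rewrite inE => /predU1P[->|]; last exact: old.
have -> : mpolyX R k = 1 *: e + Q by rewrite scale1r subrK.
have raL := L2_sub (a *: e) rL.
rewrite inner_pevalP// (inner_span_eq0 raL Qs old) addr0 mul1r.
rewrite inner_sub// (innerC (peval (a *: e))) aE//.
have [e0|e0] := eqVneq (inner (peval e) (peval e)) 0.
  rewrite e0 mulr0 subr0.
  have := inner_cauchy_schwarz rL eL; rewrite e0 mulr0 => H.
  by apply/eqP; rewrite -sqrf_eq0 eq_le H sqr_ge0.
by rewrite /a divfK// subrr.
Qed.

Lemma poly_projection n f : L2 f -> exists2 P, (msize P <= n)%N &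
  forall Q, (msize Q <= n)%N -> inner (fun x => f x - peval P x) (peval Q) = 0.
Proof.
move=> fL; pose s := map (@bmnm d n) (enum {: bmultinom d n}).
have sP m : (m \in s) = (mdeg m < n)%N.
  apply/mapP/idP => [[[k kn] _ ->]//|mn].
  by exists (BMultinom mn) => //; rewrite mem_enum.
have [P Ps Po] := monomial_projection s fL.
exists P => [|Q Qn].
  by apply/msize_leP => m nm; apply: Ps; rewrite sP -leqNgt.
apply: (inner_span_eq0 (L2_sub P fL) (s := s)) => // m.
by rewrite sP -leqNgt => nm; move/msize_leP: Qn; apply.
Qed.
End projections.

(** * Expansions in orthogonal polynomials *)

Section expansion.
Variables (R : realType) (d : nat) (w : simplex_weight R d).
Hypotheses (d_gt0 : (0 < d)%N) (hw : nonneg_parameters w).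
Local Notation poly := (mpoly d R).
Local Notation S := (@simplex R d).
Local Notation L2 := (L2_simplex w).
Local Notation inner := (inner w).
Implicit Types (f g h p : 'rV[R]_d -> R) (P Q : poly) (m : multinom d).

Definition poly_block n P : Prop := (msize P <= n.+1)%N /\
  forall Q, (msize Q <= n)%N -> poly_mean w (P * Q) = 0.

Lemma W_orthogonalP f g : L2 f -> L2 g -> W_orthogonal w f g <-> inner f g = 0.
Proof.
move=> fL gL; rewrite /W_orthogonal weighted_meanE; last exact: L2_simplexM.
by split=> [[]|fg]; last by rewrite -[weighted_mean _ _]/(inner f g) fg.
Qed.

Lemma ortho_polyP n p : ortho_poly w n p <-> exists2 P, p = peval P & poly_block n P.
Proof.
have PL := L2_peval d_gt0 hw.
split=> [[[P Pn ->] Po]|[P -> [Pn Po]]].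
  exists P => //; split => // Q Qn; rewrite -inner_peval.
  by apply/(W_orthogonalP (PL P) (PL Q)); apply: Po; exists Q.
split; first by exists P.
move=> _ [Q Qn ->]; apply/(W_orthogonalP (PL P) (PL Q)).
by rewrite inner_peval Po.
Qed.

Lemma poly_block_sub n P Q : (msize P <= n.+1)%N -> (msize Q <= n)%N ->
  (forall Q', (msize Q' <= n)%N -> inner (fun x => peval P x - peval Q x) (peval Q') = 0) ->
  poly_block n (P - Q).
Proof.
move=> Pn Qn PQ; split.
  apply: (leq_trans (msizeD_le _ _)); rewrite msizeN geq_max Pn.
  exact: leq_trans Qn _.
move=> Q' Q'n; rewrite -inner_peval -[RHS](PQ _ Q'n).
by apply: eq_weighted_mean => x _; rewrite /peval mevalB.
Qed.

(** A projection on the orthogonal polynomials of degree [n] exists: it is the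
difference of the projections on the polynomials of degree at most [n] and less
than [n]. *)
Lemma proj_orthoP n f : L2 f -> exists P, [/\ Defs.proj_ortho w n f = peval P, poly_block n P &
  forall Q, poly_block n Q -> inner (fun x => f x - peval P x) (peval Q) = 0].
Proof.
move=> fL; have PL := L2_peval d_gt0 hw.
suff [p pP] : exists p, is_proj w n f p.
  have := xgetPex (fun=> 0) (ex_intro _ p pP); rewrite -/(Defs.proj_ortho w n f).
  move=> [/ortho_polyP[P PE Pb] Po]; exists P; split => // Q Qb.
  apply/(W_orthogonalP (L2_sub d_gt0 hw P fL) (PL Q)).
  by rewrite -PE; apply: Po; apply/ortho_polyP; exists Q.
have [P1 P1n P1o] := poly_projection d_gt0 hw n.+1 fL.
have [P0 P0n P0o] := poly_projection d_gt0 hw n fL.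
have PE x : f x - peval (P1 - P0) x = (f x - peval P1 x) - peval (- P0) x.
  by rewrite /peval mevalB mevalN; ring.
have Pb : poly_block n (P1 - P0).
  apply: poly_block_sub => // Q Qn.
  have := P0o Q Qn; rewrite !inner_sub// => /eqP; rewrite subr_eq0 => /eqP <-.
  have := P1o Q (leq_trans Qn (leqnSn n)); rewrite inner_sub// => /eqP.
  by rewrite subr_eq0 => /eqP ->; rewrite subrr.
exists (peval (P1 - P0)); split; first by apply/ortho_polyP; exists (P1 - P0).
move=> _ /ortho_polyP[Q -> [Qn Qo]].
apply/(W_orthogonalP (L2_sub d_gt0 hw _ fL) (PL Q)).
rewrite (funext PE) inner_sub//; last exact: L2_sub.
by rewrite P1o// inner_peval mulrC Qo ?subrr// msizeN.
Qed.

Section partial_sums.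
Variables (f : 'rV[R]_d -> R) (P : nat -> poly).
Hypothesis fL : L2 f.
Hypothesis Pb : forall n, poly_block n (P n).
Hypothesis Po : forall n Q, poly_block n Q ->
  inner (fun x => f x - peval (P n) x) (peval Q) = 0.

Let PL := L2_peval d_gt0 hw.
Let T N := \sum_(n < N) P n.

Let msize_T N : (msize (T N) <= N)%N.
Proof.
apply: (leq_trans (msize_sum _ _ _)); apply/bigmax_leqP => i _.
exact: leq_trans (Pb i).1 _.
Qed.

(** Every polynomial is a block plus a polynomial of lower degree; the projection
of the same degree handles the block, and induction the rest. *)
Lemma partial_sum_residual N Q : (msize Q <= N)%N ->
  inner (fun x => f x - peval (T N) x) (peval Q) = 0.
Proof.
elim: N Q => [|N IH] Q QN.
  have -> : Q = 0 by apply/eqP; rewrite -msize_poly_eq0 -leqn0.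
  by rewrite inner_peval0.
have [Q' Q'N Q'o] := poly_projection d_gt0 hw N (PL Q).
have Bb := poly_block_sub QN Q'N Q'o.
have TE : T N.+1 = T N + P N by rewrite /T big_ord_recr.
have TB : inner (peval (T N)) (peval (Q - Q')) = 0.
  by rewrite inner_peval mulrC Bb.2.
have PQ' : inner (peval (P N)) (peval Q') = 0 by rewrite inner_peval (Pb N).2.
have fB := Po Bb; rewrite inner_sub// in fB.
have fQ' := IH _ Q'N; rewrite inner_sub// in fQ'.
have -> : Q = 1 *: (Q - Q') + Q' by rewrite scale1r subrK.
have resL := L2_sub d_gt0 hw (T N.+1) fL.
rewrite inner_pevalP// mul1r !inner_sub// TE.
have addE A : inner (peval (T N + P N)) (peval A) =
    inner (peval (T N)) (peval A) + inner (peval (P N)) (peval A).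
  by rewrite !(innerC _ _ (peval A)) -[T N]scale1r inner_pevalP// mul1r scale1r.
rewrite !addE TB PQ' add0r addr0.
by rewrite fB fQ' addr0.
Qed.

Lemma partial_sum_pythagoras N : inner f f =
  inner (fun x => f x - peval (T N) x) (fun x => f x - peval (T N) x) + poly_mean w (T N * T N).
Proof.
have rL := L2_sub d_gt0 hw (T N) fL.
have rT : inner (fun x => f x - peval (T N) x) (peval (T N)) = 0.
  exact: partial_sum_residual.
rewrite (inner_residual d_gt0 hw (T N) fL fL) [X in X + _]innerC [X in _ + X]innerC.
rewrite (inner_residual d_gt0 hw (T N) fL rL) (inner_residual d_gt0 hw (T N) fL (PL (T N))).
by rewrite rT add0r [inner (peval _) _]innerC rT addr0 inner_peval.
Qed.

Lemma partial_sum_sqnorm N : poly_mean w (T N * T N) = \sum_(n < N) poly_mean w (P n * P n).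
Proof.
elim: N => [|N IH]; first by rewrite /T !big_ord0 -inner_peval inner_peval0.
rewrite big_ord_recr/= -IH /T big_ord_recr/= -/(T N).
have NT : poly_mean w (P N * T N) = 0 by exact: (Pb N).2.
have lin A B C : poly_mean w ((A + B) * C) = poly_mean w (A * C) + poly_mean w (B * C).
  rewrite mulrDl -[A * C]scale1r (poly_mean_is_linear d_gt0 hw) mul1r.
  by rewrite scale1r.
have TN : poly_mean w (T N * P N) = 0 by rewrite mulrC.
have linr A B C : poly_mean w (C * (A + B)) = poly_mean w (C * A) + poly_mean w (C * B).
  by rewrite ![C * _]mulrC lin.
by rewrite lin !linr NT TN addr0 add0r.
Qed.

Lemma bessel N : \sum_(n < N) poly_mean w (P n * P n) <= inner f f.
Proof. by rewrite -partial_sum_sqnorm (partial_sum_pythagoras N) lerDr inner_ge0. Qed.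

Lemma partial_sum_best N Q : (msize Q <= N)%N ->
  inner (fun x => f x - peval (T N) x) (fun x => f x - peval (T N) x) <=
  inner (fun x => f x - peval Q x) (fun x => f x - peval Q x).
Proof.
move=> QN; pose r x := f x - peval (T N) x.
have rL : L2 r := L2_sub d_gt0 hw (T N) fL.
have fE : (fun x => f x - peval Q x) = (fun x => r x - peval (Q - T N) x).
  by apply/funext => x; rewrite /r /peval mevalB; ring.
have QT : (msize (Q - T N) <= N)%N.
  by apply: (leq_trans (msizeD_le _ _)); rewrite msizeN geq_max QN; exact: msize_T.
have rQ : inner r (peval (Q - T N)) = 0 := partial_sum_residual QT.
rewrite fE -/r; clearbody r.
have r2L := L2_sub d_gt0 hw (Q - T N) rL.
rewrite (inner_sub d_gt0 hw (Q - T N) rL r2L) innerC.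
rewrite (innerC _ (peval (Q - T N))) !inner_sub//.
by rewrite (innerC _ (peval (Q - T N)) r) rQ subr0 sub0r opprK lerDl inner_ge0.
Qed.
End partial_sums.
End expansion.

(** * Facet moment and dispersion *)

Section uncertainty.
Variables (R : realType) (d : nat) (w : simplex_weight R d).
Hypotheses (d_gt0 : (0 < d)%N) (hw : nonneg_parameters w).
Local Notation poly := (mpoly d R).
Local Notation S := (@simplex R d).
Local Notation L2 := (L2_simplex w).
Local Notation inner := (inner w).
Implicit Types (f g : 'rV[R]_d -> R).

Definition facet_moment f : R := weighted_mean w (fun x => (1 - l1norm x) * (f x * f x)).

Lemma measurable_facet : measurable_fun S (fun x : 'rV[R]_d => 1 - l1norm x).
Proof.
by apply: measurable_funTS; apply: measurable_funB => //; exact: measurable_l1norm.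
Qed.

Lemma facet_itv (x : 'rV[R]_d) : S x -> 0 <= 1 - l1norm x <= 1.
Proof. by move=> [_ ->] /=; rewrite gerBl l1norm_ge0. Qed.

Lemma facet_integrable f : L2 f ->
  weighted_integrable w (fun x => (1 - l1norm x) * (f x * f x)).
Proof.
move=> /L2_simplexP[mf fi]; apply: le_weighted_integrable fi.
  by apply: measurable_funM; [exact: measurable_facet|exact: measurable_funM].
move=> x /facet_itv/andP[t0 t1].
have ff : 0 <= f x * f x by rewrite -expr2 sqr_ge0.
by rewrite /= (ger0_norm (mulr_ge0 t0 ff)) ler_piMl.
Qed.

Lemma sqnormE f : L2 f -> weighted_integral w (fun x => `|f x| ^+ 2) = (inner f f)%:E.
Proof.
move=> fL; rewrite -weighted_meanE; last exact: L2_simplexM.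
by apply: eq_weighted_integral => x _; rewrite real_normK ?num_real// expr2.
Qed.

(** The facet is a null set and [1 - |x|] is positive off it, so that a vanishing
facet moment would make [f^2 W] vanish almost everywhere. *)
Lemma facet_moment_gt0 f : L2 f -> 0 < inner f f -> 0 < facet_moment f.
Proof.
move=> fL f1; have ti := facet_integrable fL; have fi := L2_simplexM fL fL.
have ff x : 0 <= f x * f x by rewrite -expr2 sqr_ge0.
have t0 x : S x -> 0 <= (1 - l1norm x) * (f x * f x).
  by move=> /facet_itv/andP[t0 _]; exact: mulr_ge0.
rewrite lt_neqAle weighted_mean_ge0// andbT; apply/eqP => m0.
have mS := @measurable_simplex R d.
have : ae_eq (lebesgue_rV R d) S
    (fun x => ((1 - l1norm x) * (f x * f x) * weight w x)%:E) (cst 0%E).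
  apply/(ae_eq_integral_abs (lebesgue_rV R d) mS (measurable_int _ ti)).1.
  transitivity (weighted_integral w (fun x => (1 - l1norm x) * (f x * f x))).
    apply: eq_integral => x; rewrite inE => Sx; rewrite gee0_abs// lee_fin.
    by apply: mulr_ge0 (weight_ge0 _ _); exact: t0.
  by rewrite weighted_meanE// -[weighted_mean _ _]/(facet_moment f) -m0.
move=> [A [mA A0 sA]].
have : ae_eq (lebesgue_rV R d) S (fun x => (f x * f x * weight w x)%:E) (cst 0%E).
  exists (A `|` @facet_hyperplane R d); split.
  - by apply: measurableU => //; exact: measurable_facet_hyperplane.
  - apply: eq_trans A0; apply: measureU0 => //; first exact: measurable_facet_hyperplane.
    exact: facet_hyperplane_null.
  move=> x /= xA; have [xF|xF] := pselect (@facet_hyperplane R d x); first by right.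
  left; apply: sA => /= H; apply: xA => Sx.
  have /eqP := EFin_inj (H Sx).
  rewrite -mulrA mulf_eq0 => /orP[|/eqP -> //].
  rewrite subr_eq0 => /eqP E; exfalso; apply: xF.
  by rewrite /facet_hyperplane/= -l1norm_orthant//; case: Sx.
move=> /(ae_eq_integral_abs (lebesgue_rV R d) mS (measurable_int _ fi)).2 F0.
have : weighted_integral w (fun x => f x * f x) = 0%E.
  rewrite -[RHS]F0; apply: eq_integral => x _.
  by rewrite gee0_abs// lee_fin; apply: mulr_ge0 (weight_ge0 _ _).
rewrite weighted_meanE// => -[]; rewrite -[weighted_mean _ _]/(inner f f) => E.
by rewrite E ltxx in f1.
Qed.

Definition root_moment f : 'rV[R]_d :=
  \row_i weighted_mean w (fun x => Num.sqrt (x ord0 i) * (f x * f x)).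

Lemma sqrt_coord_itv (x : 'rV[R]_d) i : S x -> 0 <= Num.sqrt (x ord0 i) <= 1.
Proof.
move=> Sx; rewrite sqrtr_ge0/= -sqrtr1 ler_sqrt//.
by have /andP[] := simplex_coord i Sx.
Qed.

Lemma root_moment_integrable f i : L2 f ->
  weighted_integrable w (fun x => Num.sqrt (x ord0 i) * (f x * f x)).
Proof.
move=> /L2_simplexP[mf fi]; apply: le_weighted_integrable fi.
  apply: measurable_funM; last exact: measurable_funM.
  apply: measurable_funTS.
  exact: (measurableT_comp (continuous_measurable_fun (@sqrt_continuous R)) (measurable_coord i)).
move=> x /(@sqrt_coord_itv _ i)/andP[t0 t1].
have ff : 0 <= f x * f x by rewrite -expr2 sqr_ge0.
by rewrite /= (ger0_norm (mulr_ge0 t0 ff)) ler_piMl.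
Qed.

Lemma root_moment_ge0 f i : 0 <= root_moment f ord0 i.
Proof.
rewrite mxE; apply: weighted_mean_ge0 => x Sx.
by rewrite mulr_ge0 ?sqrtr_ge0// -expr2 sqr_ge0.
Qed.

Lemma dispersionE f y : L2 f ->
  dispersion w f y = (inner f f - dotr (root_moment f) (psi_inv y))%:E.
Proof.
move=> fL; have fi := L2_simplexM fL fL.
have : forall s : seq 'I_d,
  weighted_integrable w (fun x : 'rV[R]_d => \sum_(i <- s) psi_inv y ord0 i * (Num.sqrt (x ord0 i) * (f x * f x))) /\
  weighted_mean w (fun x : 'rV[R]_d => \sum_(i <- s) psi_inv y ord0 i * (Num.sqrt (x ord0 i) * (f x * f x))) =
  \sum_(i <- s) root_moment f ord0 i * psi_inv y ord0 i.
  elim=> [|i s [IHi IHm]].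
    split; last first.
      rewrite big_nil (eq_weighted_mean _ (g := fun=> 0)) => [|x _]; last by rewrite big_nil.
      by rewrite /weighted_mean /weighted_integral integral0_eq// => x _; rewrite mul0r.
    apply: (bounded_weighted_integrable d_gt0 hw (M := 0)); last by move=> x _; rewrite big_nil normr0.
    by under eq_fun do rewrite big_nil; exact: measurable_cst.
  have zi := weighted_integrableZ (psi_inv y ord0 i) (root_moment_integrable i fL).
  split.
    apply: eq_weighted_integrable (weighted_integrableD zi IHi) => x _.
    by rewrite big_cons.
  rewrite (eq_weighted_mean _ (g := (fun x : 'rV[R]_d => psi_inv y ord0 i * (Num.sqrt (x ord0 i) * (f x * f x))) \+
    (fun x : 'rV[R]_d => \sum_(i <- s) psi_inv y ord0 i * (Num.sqrt (x ord0 i) * (f x * f x))))); last first.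
    by move=> x _; rewrite big_cons.
  rewrite weighted_meanD// weighted_meanZ; last exact: root_moment_integrable.
  rewrite IHm big_cons; congr (_ + _); rewrite mulrC; congr (_ * _).
  by rewrite [RHS]mxE.
move=> /(_ (index_enum _))[si sm].
rewrite /dispersion (eq_weighted_integral _ (g := (fun x : 'rV[R]_d => f x * f x) \+
  (fun x : 'rV[R]_d => -1 * \sum_i psi_inv y ord0 i * (Num.sqrt (x ord0 i) * (f x * f x))))); last first.
  move=> x _ /=; rewrite real_normK ?num_real// mulrBl mul1r expr2 mulN1r; congr (_ - _).
  rewrite /dotr mulr_suml; apply: eq_bigr => i _; rewrite !mxE; ring.
have zi := weighted_integrableZ (-1) si.
rewrite weighted_meanE; last exact: weighted_integrableD.
by rewrite weighted_meanD// weighted_meanZ// sm mulN1r.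
Qed.

Lemma dotr_sum_sq (v : 'rV[R]_d) : dotr v v = \sum_i v ord0 i ^+ 2.
Proof. by apply: eq_bigr => i _; rewrite expr2. Qed.

Lemma dotr_cauchy_schwarz (u v : 'rV[R]_d) : dotr u v ^+ 2 <= dotr u u * dotr v v.
Proof.
have dot_ge0 (x : 'rV[R]_d) : 0 <= dotr x x.
  by rewrite dotr_sum_sq; apply: sumr_ge0 => i _; rewrite sqr_ge0.
apply: discriminant_le => // r; have := dot_ge0 (u + r *: v).
have -> // : dotr (u + r *: v) (u + r *: v) = dotr u u + 2 * r * dotr u v + r ^+ 2 * dotr v v.
rewrite /dotr !mulr_sumr -!big_split/=; apply: eq_bigr => i _.
by rewrite !mxE; ring.
Qed.

Lemma dotr_psi_inv (x : 'rV[R]_d) : S x -> dotr (psi_inv x) (psi_inv x) = l1norm x.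
Proof.
move=> [x0 _]; apply: eq_bigr => i _.
by rewrite mxE -expr2 sqr_sqrtr// ger0_norm.
Qed.

(** The dispersion at [y] is [|f|^2 - <v, sqrt y>], where [v] is the vector of the
moments of the [sqrt x_i].  As [sqrt y] ranges over the part of the unit ball in
the orthant, which contains the direction of [v], the minimum is [|f|^2 - |v|]. *)
Lemma dispersion_minimum f : L2 f -> exists2 m : R,
  is_minimum [set dispersion w f y | y in S] m%:E &
  facet_moment f <= 2 * m.
Proof.
move=> fL; pose v := root_moment f.
pose r := Num.sqrt (dotr v v).
have vv0 : 0 <= dotr v v.
  by rewrite dotr_sum_sq; apply: sumr_ge0 => i _; rewrite sqr_ge0.
have r0 : 0 <= r by exact: sqrtr_ge0.
have rr : r ^+ 2 = dotr v v by rewrite sqr_sqrtr.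
have upper y : S y -> dotr v (psi_inv y) <= r.
  move=> Sy; have := dotr_cauchy_schwarz v (psi_inv y).
  rewrite dotr_psi_inv// -rr => H.
  have y1 : l1norm y <= 1 by exact: simplex_l1norm_le1.
  have H2 : dotr v (psi_inv y) ^+ 2 <= r ^+ 2.
    apply: (le_trans H); rewrite ler_piMr// exprn_ge0//.
  have [n0|/ltW n0] := leP 0 (dotr v (psi_inv y)); last exact: le_trans n0 r0.
  by move: H2; rewrite ler_pXn2r// nnegrE.
(* The square root of y is v / |v|.  For v = 0 the convention on division gives
   y = 0, which serves as well. *)
pose y : 'rV[R]_d := \row_i (v ord0 i ^+ 2 / r ^+ 2).
have y0 i : 0 <= y ord0 i by rewrite mxE divr_ge0// exprn_ge0// root_moment_ge0.
have Sy : S y.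
  split => //; rewrite subr_ge0 /l1norm.
  under eq_bigr do rewrite ger0_norm// mxE.
  rewrite -mulr_suml -dotr_sum_sq -rr.
  have [->|rn0] := eqVneq r 0; first by rewrite expr0n mul0r.
  by rewrite divff// sqrf_eq0.
have vy : dotr v (psi_inv y) = r.
  have [r00|rn0] := eqVneq r 0.
    apply/eqP; rewrite eq_le upper//= r00; apply: sumr_ge0 => i _.
    by rewrite mulr_ge0 ?root_moment_ge0// mxE sqrtr_ge0.
  rewrite /dotr (eq_bigr (fun i => v ord0 i ^+ 2 / r)) => [|i _]; last first.
    rewrite [psi_inv y ord0 i]mxE [y ord0 i]mxE -expr_div_n sqrtr_sqr ger0_norm; last first.
      by rewrite divr_ge0// root_moment_ge0.
    by rewrite mulrA expr2.
  by rewrite -mulr_suml -dotr_sum_sq -rr expr2 mulfK.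
exists (inner f f - r).
  split; first by exists y => //; rewrite dispersionE// vy.
  move=> _ [z Sz <-]; rewrite dispersionE// lee_fin lerB//; exact: upper.
have ti := facet_integrable fL.
have /L2_simplexP[mf fi] := fL.
have ff x : 0 <= f x * f x by rewrite -expr2 sqr_ge0.
have dotS x : S x -> dotr (psi_inv x) (psi_inv y) <= (l1norm x + 1) / 2.
  move=> Sx; rewrite ler_pdivlMr//.
  apply: (@le_trans _ _ (dotr (psi_inv x) (psi_inv x) + dotr (psi_inv y) (psi_inv y))).
    rewrite /dotr mulr_suml -big_split; apply: ler_sum => i _ /=.
    have := sqr_ge0 (psi_inv x ord0 i - psi_inv y ord0 i); nra.
  by rewrite !dotr_psi_inv// lerD2l simplex_l1norm_le1.
have dot0 x : 0 <= dotr (psi_inv x) (psi_inv y).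
  by apply: sumr_ge0 => i _; rewrite mulr_ge0// mxE sqrtr_ge0.
pose D (x : 'rV[R]_d) := (1 - dotr (psi_inv x) (psi_inv y)) * (f x * f x).
have di : weighted_integrable w D.
  apply: le_weighted_integrable fi.
    apply: measurable_funM; last exact: measurable_funM.
    apply: measurable_funTS; apply: measurable_funB => //.
    apply: measurable_sum => i; apply: measurable_funM => //.
    rewrite (_ : (fun x : 'rV[R]_d => psi_inv x ord0 i) = Num.sqrt \o (fun x : 'rV[R]_d => x ord0 i)).
      exact: (measurableT_comp (continuous_measurable_fun (@sqrt_continuous R)) (measurable_coord i)).
    by apply/funext => x; rewrite mxE.
  move=> x Sx; have := dotS x Sx; have := dot0 x; have := simplex_l1norm_le1 Sx => h1 h2 h3.
  have D0 : 0 <= 1 - dotr (psi_inv x) (psi_inv y) by lra.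
  by rewrite /= ger0_norm ?(mulr_ge0 D0 (ff x))// ler_piMl//; lra.
have <- : weighted_mean w D = inner f f - r.
  have : dispersion w f y = (inner f f - r)%:E by rewrite dispersionE// vy.
  move=> /(congr1 fine) /= <-; apply: eq_weighted_mean => x _.
  by rewrite /D real_normK ?num_real// expr2.
rewrite -weighted_meanZ//; apply: le_weighted_mean => //; first exact: weighted_integrableZ.
move=> x Sx; rewrite /D [leRHS]mulrA ler_wpM2r//.
have := dotS x Sx; lra.
Qed.
End uncertainty.

(** * The uncertainty inequality *)

Section spectral.
Variables (R : realType) (d : nat) (w : simplex_weight R d).
Hypotheses (d_gt0 : (0 < d)%N) (hw : nonneg_parameters w).
Local Notation poly := (mpoly d R).
Local Notation S := (@simplex R d).
Local Notation L2 := (L2_simplex w).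
Local Notation inner := (inner w).
Implicit Types (f g : 'rV[R]_d -> R).

Definition heisenberg_constant : R :=
  16 * (1 + weight_gamma w + weight_gamma w ^+ 2 + weight_beta w) + 2 * weight_gamma w ^+ 2.

Lemma heisenberg_constant_gt0 : 0 < heisenberg_constant.
Proof.
have b0 := weight_beta_gt0 hw; have g0 := weight_gamma_gt0 d_gt0 hw.
have g2 : 0 <= weight_gamma w ^+ 2 by rewrite exprn_ge0// ltW.
rewrite /heisenberg_constant; lra.
Qed.

Lemma continuous_L2 f : {within S, continuous f} -> L2 f.
Proof.
move=> cf; have [M fM] := continuous_simplex_bounded cf.
exact: (bounded_L2_simplex d_gt0 hw (measurable_continuous_simplex cf) fM).
Qed.

Lemma polynomial_L2_density f e : {within S, continuous f} -> 0 < e ->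
  exists P : poly, inner (fun x => f x - peval P x) (fun x => f x - peval P x) <= e.
Proof.
move=> cf e0; pose I1 := weighted_mean w (fun=> 1).
have I0 : 0 <= I1 by apply: weighted_mean_ge0.
pose a := Num.sqrt (e / (1 + I1)).
have eI : 0 < e / (1 + I1) by rewrite divr_gt0// ltr_pwDl.
have a0 : 0 < a by rewrite sqrtr_gt0.
have [P HP] := polynomial_approximation cf a0.
exists P.
have fPL := L2_sub d_gt0 hw P (continuous_L2 cf).
have one : weighted_integrable w (fun=> 1).
  by apply: (bounded_weighted_integrable d_gt0 hw (M := 1)) => // x _; rewrite normr1.
apply: (@le_trans _ _ (weighted_mean w (fun x => a ^+ 2 * 1))).
  apply: le_weighted_mean; [exact: L2_simplexM|exact: weighted_integrableZ|].
  move=> x Sx; rewrite mulr1 -expr2 -[leLHS]real_normK ?num_real//.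
  by rewrite ler_sqr ?nnegrE ?normr_ge0 ?(ltW a0)//; exact: HP.
rewrite weighted_meanZ// -/I1 sqr_sqrtr ?(ltW eI)// -mulrA ler_piMr ?(ltW e0)//.
by rewrite mulrC ler_pdivrMr ?mul1r ?ltr_pwDl// lerDr.
Qed.

(** [P^2 <= 2 f^2 + 2 (f - P)^2], and [1 - |x| <= 1] in the second term. *)
Lemma facet_moment_le_residual f (P : poly) : L2 f ->
  poly_mean w (facet_poly R d * (P * P)) <=
  2 * facet_moment w f + 2 * inner (fun x => f x - peval P x) (fun x => f x - peval P x).
Proof.
move=> fL; have rL := L2_sub d_gt0 hw P fL.
have ti := facet_integrable fL; have ri := L2_simplexM rL rL.
rewrite -!weighted_meanZ// -weighted_meanD; [|exact: weighted_integrableZ..].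
apply: le_weighted_mean; first exact: weighted_integrable_peval.
  by apply: weighted_integrableD; exact: weighted_integrableZ.
move=> x Sx; rewrite /= /peval !mevalM -![meval _ _]/(peval _ x) peval_facet_poly//.
have /andP[t0 t1] := facet_itv Sx.
set t := 1 - l1norm x in t0 t1 *; set a := f x; set b := peval P x.
have h1 : t * (b * b) <= t * (2 * (a * a) + 2 * ((a - b) * (a - b))).
  apply: ler_wpM2l => //; have := sqr_ge0 (2 * a - b); nra.
have h2 : t * ((a - b) * (a - b)) <= (a - b) * (a - b).
  by rewrite ler_piMl// -expr2 sqr_ge0.
lra.
Qed.

Lemma frac_laplacian_coeff n :
  n%:R ^+ 2 <= ((n%:R * (n%:R + weight_lambda w)) `^ 2^-1) ^+ 2.
Proof.
have l0 := weight_lambda_ge0 d_gt0 hw.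
have n0 : 0 <= n%:R :> R by [].
rewrite powR12_sqrt ?mulr_ge0 ?addr_ge0// sqr_sqrtr ?mulr_ge0 ?addr_ge0//.
by rewrite expr2 ler_wpM2l// lerDl.
Qed.

(** The inequality for the partial sums of the expansion of [f], whose spectral
energies are bounded by [|g|^2] thanks to Bessel's inequality for [g]. *)
Lemma spectral_heisenberg f g : {within S, continuous f} ->
  weighted_integral w f = 0%E -> inner f f = 1 -> is_frac_laplacian w 2^-1 f g ->
  weight_beta w ^+ 2 <= 16 * heisenberg_constant * facet_moment w f * inner g g.
Proof.
move=> cf f0 f1 [gL gf]; have fL := continuous_L2 cf.
have /choice[P HP] : forall n, exists P, [/\ Defs.proj_ortho w n f = peval P, poly_block w n P &
  forall Q, poly_block w n Q -> inner (fun x => f x - peval P x) (peval Q) = 0].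
  by move=> n; exact: proj_orthoP.
have /choice[G HG] : forall n, exists P, [/\ Defs.proj_ortho w n g = peval P, poly_block w n P &
  forall Q, poly_block w n Q -> inner (fun x => g x - peval P x) (peval Q) = 0].
  by move=> n; exact: proj_orthoP.
have Pb n : poly_block w n (P n) by case: (HP n).
have Po n Q : poly_block w n Q -> inner (fun x => f x - peval (P n) x) (peval Q) = 0.
  by case: (HP n) => _ _; apply.
have Gb n : poly_block w n (G n) by case: (HG n).
have Go n Q : poly_block w n Q -> inner (fun x => g x - peval (G n) x) (peval Q) = 0.
  by case: (HG n) => _ _; apply.
have PP n : 0 <= poly_mean w (P n * P n) by rewrite -inner_peval inner_ge0.
have energy_le N : \sum_(n < N) n%:R ^+ 2 * poly_mean w (P n * P n) <= inner g g.
  apply: le_trans (bessel d_gt0 hw gL Gb Go N); apply: ler_sum => n _.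
  pose c := (n%:R * (n%:R + weight_lambda w)) `^ 2^-1.
  have -> : poly_mean w (G n * G n) = c ^+ 2 * poly_mean w (P n * P n).
    rewrite -weighted_meanZ; last exact: weighted_integrable_peval.
    apply: eq_weighted_mean => x _; rewrite /peval !mevalM.
    have [GE _ _] := HG n; have [PE _ _] := HP n.
    have := gf n x; rewrite GE PE /peval => ->; rewrite /c; ring.
  by rewrite ler_wpM2r// frac_laplacian_coeff.
have P00 : poly_mean w (P 0 * P 0) = 0.
  have := Po 0 _ (Pb 0); rewrite inner_sub//; last exact: L2_peval.
  rewrite inner_peval => /eqP; rewrite subr_eq0 => /eqP <-.
  rewrite (msize1_polyC (Pb 0).1).
  set c := mcoeff _ _.
  have fi : weighted_integrable w f.
    have [M fM] := continuous_simplex_bounded cf.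
    exact: (bounded_weighted_integrable d_gt0 hw (measurable_continuous_simplex cf) fM).
  transitivity (weighted_mean w (fun x => c * f x)).
    by apply: eq_weighted_mean => x _; rewrite /peval mevalC mulrC.
  by rewrite weighted_meanZ// /weighted_mean f0 mulr0.
have d0 : 0 < facet_moment w f by apply: facet_moment_gt0 => //; rewrite f1.
have K0 := ltW heisenberg_constant_gt0.
(* An error of at most 1/2 leaves half of the squared norm of f in the partial sum,
   and an error of at most the facet moment bounds that of the partial sum by 4
   times that of f. *)
pose e := Num.min (2^-1) (facet_moment w f).
have e0 : 0 < e by rewrite lt_min d0 invr_gt0 ltr0n.
have [Q HQ] := polynomial_L2_density cf e0.
pose N := msize Q; pose T := \sum_(n < N) P n.
have re : inner (fun x => f x - peval T x) (fun x => f x - peval T x) <= e.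
  by apply: le_trans HQ; apply: partial_sum_best.
have TT := partial_sum_pythagoras d_gt0 hw fL Pb Po N.
rewrite f1 -/T in TT.
have tT := facet_moment_le_residual T fL.
have := poly_heisenberg d_gt0 hw N Pb P00; rewrite -/T -/heisenberg_constant /= => H.
have TT2 : 2^-1 <= poly_mean w (T * T).
  have : e <= 2^-1 by rewrite ge_min lexx.
  lra.
have tT4 : poly_mean w (facet_poly R d * (T * T)) <= 4 * facet_moment w f.
  have : e <= facet_moment w f by rewrite ge_min lexx orbT.
  lra.
have b0 := weight_beta_gt0 hw.
have EN := energy_le N.
set E := \sum_(n < N) _ in H EN.
have E0 : 0 <= E by apply: sumr_ge0 => n _; rewrite mulr_ge0// exprn_ge0.
have h1 : (weight_beta w / 2) ^+ 2 <= (weight_beta w * poly_mean w (T * T)) ^+ 2.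
  rewrite ler_pXn2r ?nnegrE//; [|by rewrite ltW// divr_gt0|by rewrite mulr_ge0 ?ltW//; lra].
  by rewrite ler_wpM2l// ltW.
have h2 : heisenberg_constant * poly_mean w (facet_poly R d * (T * T)) * E <=
    heisenberg_constant * (4 * facet_moment w f) * inner g g.
  apply: (@le_trans _ _ (heisenberg_constant * (4 * facet_moment w f) * E)).
    by apply: ler_wpM2r => //; exact: ler_wpM2l.
  by apply: ler_wpM2l => //; rewrite mulr_ge0// mulr_ge0// ltW.
have := le_trans h1 (le_trans H h2); rewrite expr_div_n; lra.
Qed.
End spectral.

Theorem theorem5p2 (R : realType) (d : nat) (hd : (0 < d)%N)
    (w : simplex_weight R d) (hw : nonneg_parameters w) :
  exists2 C : R, 0 < C &
    forall f : 'rV[R]_d -> R,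
      C1_simplex f ->
      weighted_integral w f = 0%E ->
      weighted_integral w (fun x => `|f x| ^+ 2) = 1%E ->
      exists2 m : \bar R,
        is_minimum [set dispersion w f y | y in @simplex R d] m &
        (C%:E <= m * sqrt_laplacian_sqnorm w f)%E.
Proof.
pose K := heisenberg_constant w.
have b0 := weight_beta_gt0 hw.
have K0 : 0 < K := heisenberg_constant_gt0 hd hw.
exists (weight_beta w ^+ 2 / (32 * K)) => [|f [cf _] f0 f1].
  by rewrite divr_gt0 ?exprn_gt0// mulr_gt0.
have fL := continuous_L2 hd hw cf.
have ff : inner w f f = 1.
  by apply: EFin_inj; rewrite -sqnormE.
have [m mmin mle] := dispersion_minimum hd hw fL.
exists m%:E => //.
have d0 : 0 < facet_moment w f by apply: facet_moment_gt0 => //; rewrite ff.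
have m0 : 0 < m by lra.
(* Bounding every candidate g from below by the same number also covers the
   case of an infimum over the empty set. *)
apply: (@le_trans _ _ (m%:E * (weight_beta w ^+ 2 / (32 * K) / m)%:E)%E).
  by rewrite -EFinM lee_fin [leRHS]mulrC divfK// gt_eqF.
apply: lee_wpmul2l; first by rewrite lee_fin ltW.
apply: le_ereal_inf_tmp => _ [g gf <-].
have gL := gf.1.
rewrite (sqnormE gL) lee_fin ler_pdivrMr// ler_pdivrMr ?mulr_gt0//.
have H := spectral_heisenberg hd hw cf f0 ff gf.
apply: (le_trans H).
have gg := inner_ge0 w g.
rewrite -/K.
have -> : inner w g g * m * (32 * K) = 16 * K * (2 * m) * inner w g g by ring.
apply: ler_wpM2r => //; apply: ler_wpM2l => //.
by rewrite mulr_ge0 ?ltW.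
Qed.
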